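(* Let $K\ge 4$ be an integer and put \[ a=2K-3,\quad b=2K-1,\quad c=4K^2-16K+11,\quad d=2K-5,\quad m=\left\lceil K^2-\tfrac{7}{2}K+2\right\rceil .\] Then there is a negative curve in the blowup $\operatorname{Bl}_e\mathbb{P}(a,b,c)$, with $m$ its order of vanishing at $e$. The triangle $\Delta_K$ corresponding to the weighted projective plane $\mathbb{P}(a,b,c)$ and supporting this curve has horizontal base, and left and right slopes \[ s=\frac{a}{d}=1+\frac{2}{2K-5},\qquad t=\frac{b}{2}=K-\frac12 .\] For even $K$, the triangle $\Delta_K$ has vertices \[ \left(-\frac1a,0\right),\quad (m-K+2,0),\quad \left(m,\frac{(K-2)b}{2}\right).\] For odd $K$, the triangle $\Delta_K$ has vertices \[ (0,0),\quad (m-K+2,0),\quad \left(\frac{K-1}{2}+\frac1c\right)(d,a).\]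
   Context: We work over an algebraically closed field $k$ of characteristic zero. For a plane triangle $\Delta$ with rational edge slopes, $X_\Delta$ is the projective toric surface (of Picard number 1) defined by the normal fan of $\Delta$; two triangles that differ by translation and scaling (parallel triangles) define the same variety. The point $e=(1,1)$ is the identity of the torus $T\subseteq X_\Delta$ (blowing up a general point means blowing up $e$), $X=\operatorname{Bl}_e X_\Delta$, and $E$ is the exceptional curve. A negative curve in $X$ is an irreducible curve $C\neq E$ with $C\cdot C\le 0$. Such a curve is the strict transform of the closure of the zero locus in $T$ of an irreducible Laurent polynomial $\xi(x,y)$; its order of vanishing at $e$ is the order $m$ of vanishing of $\xi$ at $e$, and it is supported in a triangle $\Delta$ if the Newton polygon of $\xi$ (up to translation) lies in $\Delta$ (one then has $C\cdot C=2\operatorname{Area}(\Delta)-m^2$ when $\Delta$ is the smallest triangle in its parallel class containing the Newton polygon). A triangle with horizontal base and left, right slopes $s$, $t$, $0<s<t$, has its left edge of slope $s$ and its right edge of slope $t$. *)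

(* Defs.v *)
From HB Require Import structures.
From mathcomp Require Import all_boot all_order all_algebra.
From mathcomp Require Import finmap monalg.

Set Implicit Arguments.
Unset Strict Implicit.
Unset Printing Implicit Defensive.

Import Order.TTheory GRing.Theory Num.Theory.
Local Open Scope fset_scope.
Local Open Scope ring_scope.

(* ------------------------------------------------------------------ *)
(* The ring R[x^+-1, y^+-1], i.e. the group algebra of Z^2.  The      *)
(* library makes {malg R[M]} a ring only for monoids M without        *)
(* nontrivial units, so convolution is redone here on an alias.       *)

Definition laurent (R : comNzRingType) : Type := {malg R[(int * int)%type]}.

Section LaurentRing.
Context (R : comNzRingType).
Local Notation Z2 := (int * int)%type.
Local Notation L := {malg R[Z2]}.
Implicit Types (f g h : L) (u v : Z2) (A B : {fset Z2}).

Definition lmul f g : L :=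
  \sum_(u <- msupp f) \sum_(v <- msupp g) << f@_u * g@_v *g (u + v)%R >>.

Definition lone : L := << 1 *g (0 : Z2) >>.

Lemma lmulEw A B f g : msupp f `<=` A -> msupp g `<=` B ->
  lmul f g = \sum_(u <- A) \sum_(v <- B) << f@_u * g@_v *g (u + v)%R >>.
Proof.
move=> leA leB; rewrite /lmul (big_fset_incl _ leA) /=.
  apply/eq_bigr=> u _; apply/big_fset_incl => // v _ /mcoeff_outdom ->.
  by rewrite mulr0 monalgU0.
move=> u _ /mcoeff_outdom fu.
by rewrite big1 // => v _; rewrite fu mul0r monalgU0.
Qed.

Lemma lmulC : commutative lmul.
Proof.
move=> f g; rewrite /lmul exchange_big; apply/eq_bigr=> v _.
by apply/eq_bigr=> u _; rewrite mulrC addrC.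
Qed.

Lemma lmul0 g : lmul 0 g = 0.
Proof. by rewrite /lmul msupp0 big_seq_fset0. Qed.

Lemma lmulU c u g :
  lmul << c *g u >> g = \sum_(v <- msupp g) << c * g@_v *g (u + v)%R >>.
Proof.
rewrite (lmulEw (msuppU_le) (fsubset_refl _)) big_seq_fset1.
by apply/eq_bigr => v _; rewrite mcoeffUU.
Qed.

Lemma lmulUU c d u v :
  lmul << c *g u >> << d *g v >> = << c * d *g (u + v)%R >>.
Proof. by rewrite (lmulEw msuppU_le msuppU_le) !big_seq_fset1 !mcoeffUU. Qed.

Lemma lmul1 : left_id lone lmul.
Proof.
move=> g; rewrite lmulU [RHS]monalgE.
by apply/eq_bigr=> u _; rewrite mul1r add0r.
Qed.

Lemma lmulDl : left_distributive lmul +%R.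
Proof.
move=> f g h.
rewrite [in RHS](lmulEw (fsubsetUl _ (msupp g)) (fsubset_refl _)).
rewrite [in RHS](lmulEw (fsubsetUr (msupp f) _) (fsubset_refl _)).
rewrite (lmulEw (msuppD_le _ _) (fsubset_refl _)).
rewrite -big_split /=; apply/eq_bigr=> u _.
rewrite -big_split /=; apply/eq_bigr=> v _.
by rewrite mcoeffD mulrDl monalgUD.
Qed.

Lemma lmulDr f g h : lmul f (g + h) = lmul f g + lmul f h.
Proof. by rewrite lmulC lmulDl !(lmulC f). Qed.

Lemma lmul_suml (I : Type) (r : seq I) (F : I -> L) g :
  lmul (\sum_(i <- r) F i) g = \sum_(i <- r) lmul (F i) g.
Proof. exact: (big_morph (lmul^~ g) (fun _ _ => lmulDl _ _ _) (lmul0 g)). Qed.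

Lemma lmul_sumr (I : Type) (r : seq I) (F : I -> L) g :
  lmul g (\sum_(i <- r) F i) = \sum_(i <- r) lmul g (F i).
Proof. by rewrite lmulC lmul_suml; apply/eq_bigr=> i _; rewrite lmulC. Qed.

Lemma lmulEl f g : lmul f g = \sum_(u <- msupp f) lmul << f@_u *g u >> g.
Proof. by apply/eq_bigr=> u _; rewrite lmulU. Qed.

Lemma lmulEr f g : lmul f g = \sum_(v <- msupp g) lmul f << g@_v *g v >>.
Proof. by rewrite lmulC lmulEl; apply/eq_bigr=> v _; rewrite lmulC. Qed.

Lemma lmulA : associative lmul.
Proof.
move=> f g h; rewrite [LHS]lmulEl (lmulEl f g) lmul_suml.
apply/eq_bigr=> u _; rewrite (lmulEl g h) lmul_sumr (lmulEr _ g) lmul_suml.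
apply/eq_bigr=> v _; rewrite (lmulEr _ h) lmul_sumr [RHS]lmulEr.
by apply/eq_bigr=> w _; rewrite !lmulUU mulrA addrA.
Qed.

Lemma lone_neq0 : lone != 0.
Proof. by rewrite monalgU_eq0 oner_eq0. Qed.

HB.instance Definition _ := GRing.Zmodule.on (laurent R).
HB.instance Definition _ := GRing.Zmodule_isComNzRing.Build (laurent R)
  lmulA lmulC lmul1 lmulDl lone_neq0.

Definition lX : laurent R := << 1 *g ((1, 0) : Z2) >>.
Definition lY : laurent R := << 1 *g ((0, 1) : Z2) >>.

End LaurentRing.

Arguments lX {R}.
Arguments lY {R}.

Definition is_unit (A : comNzRingType) (x : A) : Prop := exists y, x * y = 1.

Definition irreducible_elt (A : comNzRingType) (x : A) : Prop :=
  [/\ x <> 0, ~ is_unit x &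
      forall y z : A, x = y * z -> is_unit y \/ is_unit z].

(* The products (x-1)^i (y-1)^(n-i) generate the n-th power of the    *)
(* maximal ideal (x-1, y-1) of e = (1,1).                             *)
Definition in_max_ideal_pow (R : comNzRingType) (n : nat) (f : laurent R) :
    Prop :=
  exists g : 'I_n.+1 -> laurent R,
    f = \sum_(i < n.+1) (lX - 1) ^+ i * (lY - 1) ^+ (n - i) * g i.

Definition order_at_e (R : comNzRingType) (f : laurent R) (n : nat) : Prop :=
  in_max_ideal_pow n f /\ ~ in_max_ideal_pow n.+1 f.

(* ------------------------------------------------------------------ *)
(* Plane convex geometry over Q.                                      *)

Definition point : Type := (rat * rat)%type.

Definition of_lattice (u : int * int) : point := (u.1%:~R, u.2%:~R).

Definition conv_hull (S : point -> Prop) (p : point) : Prop :=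
  exists n (w : 'I_n -> rat) (q : 'I_n -> point),
    [/\ forall i, 0 <= w i /\ S (q i), \sum_i w i = 1,
        p.1 = \sum_i w i * (q i).1 & p.2 = \sum_i w i * (q i).2].

Definition newton_polygon (R : comNzRingType) (f : laurent R) :
    point -> Prop :=
  conv_hull (fun p => exists2 u : int * int, u \in msupp f & p = of_lattice u).

(* A triangle is the family of its vertices. *)
Definition triangle : Type := 'I_3 -> point.

Definition mk_triangle (p0 p1 p2 : point) : triangle :=
  fun i => nth p0 [:: p0; p1; p2] i.

Definition region (D : triangle) : point -> Prop :=
  conv_hull (fun p => exists i, p = D i).

Definition area (D : triangle) : rat :=
  let p := D (@Ordinal 3 0 isT) in let q := D (@Ordinal 3 1 isT) in let r := D (@Ordinal 3 2 isT) in
  `| (q.1 - p.1) * (r.2 - p.2) - (r.1 - p.1) * (q.2 - p.2) | / 2.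

(* For l > 0, these are the triangles parallel to D. *)
Definition homothet (l : rat) (v : point) (D : triangle) : triangle :=
  fun i => (l * (D i).1 + v.1, l * (D i).2 + v.2).

(* Edge i of a triangle is the one opposite to vertex i. *)
Definition primitive_inner_normal (D : triangle) (i : 'I_3) (n : int * int) :
    Prop :=
  let dot (p : point) := n.1%:~R * p.1 + n.2%:~R * p.2 in
  gcdz n.1 n.2 = 1 /\
  exists h : rat, h < dot (D i) /\ forall j, j != i -> dot (D j) = h.

(* ------------------------------------------------------------------ *)
(* Toric surfaces X_D and curves in Bl_e X_D.                         *)

(* X_D = P(w0, w1, w2): the rays of the fan of P(w0, w1, w2) are the  *)
(* images of the standard basis of Z^3 in Z^3 / Z(w0, w1, w2).  The   *)
(* condition says that sending them to the rays n_i of the normal fan *)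
(* of D identifies this quotient with Z^2, the weight w_i belonging to     *)
(* edge i.                                                            *)
Definition toric_surface_is_wps (D : triangle) (w0 w1 w2 : int) : Prop :=
  exists n : 'I_3 -> int * int,
    [/\ forall i, primitive_inner_normal D i (n i),
        forall u : int * int, exists z : 'I_3 -> int,
          u.1 = \sum_i z i * (n i).1 /\ u.2 = \sum_i z i * (n i).2 &
        forall z : 'I_3 -> int,
          (\sum_i z i * (n i).1 = 0 /\ \sum_i z i * (n i).2 = 0) <->
          (exists t, forall i, z i = t * nth 0 [:: w0; w1; w2] i)].

(* Translations are by lattice vectors, i.e. multiplication of f by a *)
(* monomial.                                                          *)
Definition supported_in (R : comNzRingType) (f : laurent R) (D : triangle) :
    Prop :=
  exists u : int * int,
    forall p, newton_polygon f p -> region D (p + of_lattice u).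

Definition smallest_supporting (R : comNzRingType) (f : laurent R)
    (D : triangle) : Prop :=
  supported_in f D /\
  forall (l : rat) (v : point),
    0 < l -> supported_in f (homothet l v D) -> 1 <= l.

(* C.C = 2 Area - m^2 in Bl_e X_D, for C the strict transform of the  *)
(* closure of the zero locus of f in the torus; it depends on D only  *)
(* through its parallel class.                                        *)
Definition self_intersection (R : comNzRingType) (D : triangle)
    (f : laurent R) (q : rat) : Prop :=
  exists (l : rat) (v : point) (m : nat),
    [/\ 0 < l, smallest_supporting f (homothet l v D), order_at_e f m &
        q = 2 * area (homothet l v D) - m%:R ^+ 2].

(* f defines a negative curve in Bl_e X_D. *)
Definition negative_curve (R : comNzRingType) (D : triangle)
    (f : laurent R) : Prop :=
  irreducible_elt f /\ exists2 q, self_intersection D f q & q <= 0.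

Definition has_slope (p q : point) (s : rat) : Prop :=
  p.1 != q.1 /\ (q.2 - p.2) / (q.1 - p.1) = s.

(* Vertices 0, 1, 2 are the left end of the base, the right end of    *)
(* the base, and the apex.                                            *)
Definition horizontal_base_slopes (D : triangle) (s t : rat) : Prop :=
  let p := D (@Ordinal 3 0 isT) in let q := D (@Ordinal 3 1 isT) in let r := D (@Ordinal 3 2 isT) in
  [/\ p.2 = q.2 /\ p.1 < q.1, p.2 < r.2, has_slope p r s, has_slope q r t &
      0 < s < t].

(* Main.v *)
(* Let e be 1 for even K and 0 for odd K, let 2 m + e = d (K - 1) and
   2 h + e = a (K - 1).  The lattice points of the triangle are the solutions of
   0 <= y, d y <= a x + e, 2 (y - h) + (1 - e) >= b (x - m).  They lie in the columns
   x = 0, ..., m; columns 0, ..., m - 1 have, in some order, 1, ..., m points and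
   column m only has the point (m, h).  So there are m (m + 1) / 2 + 1 points, one
   more than the number of conditions imposed by order m at (1, 1), and some f != 0
   in the span satisfies them.  Killing the columns in order of size by the moments
   sum f_(x, y) A(x) R(y) = 0, deg A + deg R < m, shows that the coefficient at
   (m, h) of such an f is nonzero, which makes its order exactly m; the coefficient
   at the origin is nonzero as well.

   If f = g g', translated to have the origin in both supports, then widths and
   orders are both additive, which forces the order of each factor to be its width,
   and by additivity of support functions one of the factors, say g, is supported
   in a triangle 0 <= y, d y <= a x, 2 (y - t) >= b (x - p) with d t = a p, where p
   is its order.  A combination of moments of g seeing only its last two columns
   then gives g_(p, t) = 0 unless p = 0, so that g is a monomial.  The same
   statement applied to f shows, for odd K, that f touches the right edge. *)

Require Import Defs.
From mathcomp Require Import all_boot all_order all_algebra.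
From mathcomp Require Import finmap monalg zify ring lra.
Set Implicit Arguments.
Unset Strict Implicit.
Unset Printing Implicit Defensive.
Import Order.TTheory GRing.Theory Num.Theory.
Local Open Scope fset_scope.
Local Open Scope ring_scope.

(** * Moments and the order of vanishing at (1, 1) *)

Section LatticeSums.
Context {k : fieldType} {V : lmodType k}.
Implicit Types (f g : laurent k) (phi : int * int -> V) (u v : int * int).

Definition lsum phi f : V := \sum_(u <- msupp f) f@_u *: phi u.

Lemma lsumEw (A : {fset int * int}) phi f :
  msupp f `<=` A -> lsum phi f = \sum_(u <- A) f@_u *: phi u.
Proof.
move=> fA; rewrite /lsum (big_fset_incl _ fA) // => u _ /mcoeff_outdom ->.
by rewrite scale0r.
Qed.

Lemma lsumD phi : {morph lsum phi : f g / f + g}.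
Proof.
move=> f g; rewrite (lsumEw phi (msuppD_le f g)).
rewrite (lsumEw phi (fsubsetUl _ (msupp g))) (lsumEw phi (fsubsetUr (msupp f) _)).
by rewrite -big_split /=; apply/eq_bigr => u _; rewrite mcoeffD scalerDl.
Qed.

Lemma lsum0 phi : lsum phi 0 = 0.
Proof. by rewrite /lsum msupp0 big_seq_fset0. Qed.

Lemma lsum_sum (I : Type) (r : seq I) (P : pred I) (F : I -> laurent k) phi :
  lsum phi (\sum_(i <- r | P i) F i) = \sum_(i <- r | P i) lsum phi (F i).
Proof. exact: (big_morph (lsum phi) (lsumD phi) (lsum0 phi)). Qed.

Lemma lsumU phi c u : lsum phi (<< c *g u >> : laurent k) = c *: phi u.
Proof. by rewrite (lsumEw phi msuppU_le) big_seq_fset1 mcoeffUU. Qed.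

Lemma lsumM phi f g : lsum phi (f * g) =
  \sum_(u <- msupp f) \sum_(v <- msupp g) (f@_u * g@_v) *: phi (u + v).
Proof.
rewrite [f * g]/(lmul f g) /lmul lsum_sum; apply: eq_bigr => u _.
by rewrite lsum_sum; apply: eq_bigr => v _; rewrite lsumU.
Qed.

End LatticeSums.

Section Moments.
Context {k : fieldType}.
Implicit Types (f g : laurent k) (u v : int * int) (A R : {poly k}).

(** The point (x, y) becomes x + y T, so that the coefficients in T of its n-th power carry all
    monomials of degree n in x and y at once. *)
Definition lin u : {poly k} := u.1%:~R%:P + u.2%:~R *: 'X.

Lemma linD u v : lin (u + v) = lin u + lin v.
Proof. by rewrite /lin /= !rmorphD /= scalerDl addrACA. Qed.

(* n! times the coefficient of s^n in f (e^s, e^(s T)). *)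
Definition moment n f : {poly k} := lsum (fun u => lin u ^+ n) f.

(** The expansion of f (e^s, e^(s T)) has no term of degree below n in s: in characteristic zero,
    the order of f at (1, 1) is at least n. *)
Definition vanishes n f := forall i, (i < n)%N -> moment i f = 0.

Lemma momentM n f g : moment n (f * g) =
  \sum_(i < n.+1) moment (n - i) f * moment i g *+ 'C(n, i).
Proof.
rewrite /moment lsumM.
under [RHS]eq_bigr => i _.
  rewrite /lsum mulr_suml -sumrMnl.
  under eq_bigr => u _ do rewrite mulr_sumr -sumrMnl.
  over.
rewrite [RHS]exchange_big; apply: eq_bigr => u _ /=.
rewrite [RHS]exchange_big; apply: eq_bigr => v _ /=.
rewrite linD exprDn scaler_sumr; apply: eq_bigr => i _.
by rewrite -scalerAl -scalerAr scalerA scalerMnr.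
Qed.

Lemma vanishes0 f : vanishes 0 f.
Proof. by []. Qed.

Lemma vanishesD n f g : vanishes n f -> vanishes n g -> vanishes n (f + g).
Proof. by move=> vf vg i ni; rewrite /moment lsumD -!/(moment _ _) vf // vg // addr0. Qed.

Lemma vanishes_sum n (I : Type) (r : seq I) (F : I -> laurent k) :
  (forall i, vanishes n (F i)) -> vanishes n (\sum_(i <- r) F i).
Proof.
move=> vF; elim/big_rec: _ => [i _|i g _ vg]; first exact: lsum0.
exact: vanishesD.
Qed.

Lemma vanishesM m n f g :
  vanishes m f -> vanishes n g -> vanishes (m + n) (f * g).
Proof.
move=> vf vg i imn; rewrite momentM big1 // => j _; have := ltn_ord j.
have [ijm|mij] := ltnP (i - j) m; first by rewrite vf // mul0r mul0rn.
by move=> ji; rewrite [moment j g]vg ?mulr0 ?mul0rn //; lia.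
Qed.

(** In the binomial expansion of the moment of a product, every term but one has a factor moment of
    f below m or of g below n. *)
Lemma moment_leading m n f g : vanishes m f -> vanishes n g ->
  moment (m + n) (f * g) = moment m f * moment n g *+ 'C(m + n, n).
Proof.
move=> vf vg; have nlt : (n < (m + n).+1)%N by lia.
rewrite momentM (bigD1 (Ordinal nlt)) //= addnK big1 ?addr0 // => j jn.
have {}jn : (j != n :> nat) by apply: contraNneq jn => jn; apply/eqP/val_inj.
have := ltn_ord j.
have [mnjm|mmnj] := ltnP (m + n - j) m; first by rewrite vf // mul0r mul0rn.
by move=> jmn; rewrite [moment j g]vg ?mulr0 ?mul0rn //; lia.
Qed.

Lemma vanishesX m n f : vanishes m f -> vanishes (m * n) (f ^+ n).
Proof.
move=> vf; elim: n => [|n IHn]; first by rewrite muln0.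
by rewrite exprS mulnS; apply: vanishesM.
Qed.

Lemma vanishes_monom_sub1 u : vanishes 1 ((<< 1 *g u >> : laurent k) - 1).
Proof.
case=> // _; rewrite -[- 1](_ : (<< -1 *g 0 >> : laurent k) = _); last first.
  exact: (raddfN (mkmalgU (0 : int * int)) (1 : k)).
by rewrite /moment lsumD !lsumU !expr0 scaleN1r scale1r subrr.
Qed.

(** Each generator is a product of n factors of order at least 1, and orders add up under
    multiplication. *)
Lemma ideal_vanishes n f : in_max_ideal_pow n f -> vanishes n f.
Proof.
case=> g ->; apply: vanishes_sum => i.
rewrite -[X in vanishes X](addn0 n); apply: vanishesM; last exact: vanishes0.
have {1}-> : n = (1 * i + 1 * (n - i))%N by have := ltn_ord i; lia.
by apply: vanishesM; apply: vanishesX; apply: vanishes_monom_sub1.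
Qed.

Hypothesis char0 : [pchar k] =i pred0.

Lemma natr_neq0 n : (n%:R != 0 :> k) = (n != 0%N).
Proof. by rewrite (pcharf0P _).1. Qed.

Lemma order_exists n f : ~ vanishes n.+1 f ->
  exists i, [/\ (i <= n)%N, vanishes i f & moment i f != 0].
Proof.
move=> nf; have [/existsP[j fj]|/existsPn f0] :=
  boolP [exists j : 'I_n.+1, moment j f != 0]; last first.
  by case: nf => i lt_in; have /negPn/eqP := f0 (Ordinal lt_in).
have exj : exists j, (moment j f != 0) && (j <= n)%N by exists j; rewrite fj -ltnS ltn_ord.
case: (ex_minnP exj) => i /andP[fi lein] mini.
exists i; split=> // l li; apply/eqP; apply: contraTT li => fl.
by rewrite -leqNgt; have [ln|nl] := leqP l n; [apply: mini; rewrite fl ln | lia].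
Qed.

(** Orders are additive because [{poly k}] is a domain and binomial coefficients are nonzero in
    characteristic zero. *)
Lemma moment_leading_neq0 m n f g : vanishes m f -> vanishes n g ->
  moment m f != 0 -> moment n g != 0 -> moment (m + n) (f * g) != 0.
Proof.
move=> vf vg fm gn; rewrite moment_leading // -scaler_nat scaler_eq0 mulf_eq0.
by rewrite (negPf fm) (negPf gn) !orbF natr_neq0 -lt0n bin_gt0 leq_addl.
Qed.

Lemma intr_eq0_char0 (z : int) : (z%:~R == 0 :> k) = (z == 0).
Proof.
by case: z => n; rewrite -?pmulrn ?NegzE ?mulrNz ?oppr_eq0 (pcharf0P _).1.
Qed.

Definition pairing (phi : int * int -> k) f : k :=
  \sum_(u <- msupp f) f@_u * phi u.

(** The coefficient of T^j in (x + y T)^(i + j) is x^i y^j times a binomial coefficient, which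
    characteristic zero allows to cancel. *)
Lemma vanishes_monomial n f i j : vanishes n f -> (i + j < n)%N ->
  pairing (fun u => u.1%:~R ^+ i * u.2%:~R ^+ j) f = 0.
Proof.
move=> vf ijn; have /(congr1 (fun q : {poly k} => q`_j)) := vf _ ijn.
rewrite coef0 /moment /lsum coef_sum => sum0.
have bin0 : 'C(i + j, j)%:R != 0 :> k by rewrite natr_neq0 -lt0n bin_gt0 leq_addl.
apply: (mulfI bin0); rewrite mulr0 -sum0 mulr_sumr; apply: eq_bigr => u _.
rewrite coefZ /lin exprDn coef_sum.
have jlt : (j < (i + j).+1)%N by lia.
rewrite (bigD1 (Ordinal jlt)) //= big1 ?addr0.
  rewrite addnK coefMn -polyC_exp mul_polyC exprZn coefZ coefZ coefXn eqxx.
  by rewrite /= mulr1 -[in RHS]mulr_natl mulrCA.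
move=> l lj; rewrite coefMn -polyC_exp mul_polyC exprZn !coefZ coefXn.
rewrite (_ : (j == l) = false) ?mulr0 ?mul0rn //.
by apply: contraNF lj => /eqP jl; apply/eqP/val_inj.
Qed.

Lemma vanishes_test n f A R : vanishes n f -> (size A + size R <= n.+1)%N ->
  pairing (fun u => A.[u.1%:~R] * R.[u.2%:~R]) f = 0.
Proof.
move=> vf sAR.
transitivity (\sum_(i < size A) \sum_(j < size R) A`_i * R`_j *
    pairing (fun u => u.1%:~R ^+ i * u.2%:~R ^+ j) f).
  under eq_bigr => i _ do under eq_bigr => j _ do rewrite mulr_sumr.
  under eq_bigr => i _ do rewrite exchange_big.
  rewrite exchange_big; apply: eq_bigr => u _ /=.
  rewrite !horner_coef mulr_suml mulr_sumr; apply: eq_bigr => i _.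
  rewrite mulr_sumr mulr_sumr; apply: eq_bigr => j _.
  by ring.
apply: big1 => i _; apply: big1 => j _.
by rewrite (vanishes_monomial vf) ?mulr0 //; have := ltn_ord i; have := ltn_ord j; lia.
Qed.

End Moments.

(** * Supports of products *)

Section Supports.
Context {k : fieldType}.
Implicit Types (f g : laurent k) (u v w : int * int).

Definition dot w u : int := w.1 * u.1 + w.2 * u.2.

Lemma dotD w u v : dot w (u + v) = dot w u + dot w v.
Proof. by rewrite /dot /=; ring. Qed.

(** The vector w and its rotation by a right angle have determinant |w|^2, which is nonzero. *)
Lemma dot_inj w u v : w != 0 -> dot w u = dot w v ->
  dot (- w.2, w.1) u = dot (- w.2, w.1) v -> u = v.
Proof.
case: w u v => [w1 w2] [u1 u2] [v1 v2]; rewrite /dot /= => w0 e1 e2.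
have nz : w1 ^+ 2 + w2 ^+ 2 != 0.
  apply: contraNneq w0 => /eqP; rewrite paddr_eq0 ?sqr_ge0 // !sqrf_eq0.
  by move=> /andP[/eqP-> /eqP->].
have E1 : (w1 ^+ 2 + w2 ^+ 2) * u1 = (w1 ^+ 2 + w2 ^+ 2) * v1.
  transitivity (w1 * (w1 * u1 + w2 * u2) - w2 * (- w2 * u1 + w1 * u2)); first by ring.
  by rewrite e1 e2; ring.
have E2 : (w1 ^+ 2 + w2 ^+ 2) * u2 = (w1 ^+ 2 + w2 ^+ 2) * v2.
  transitivity (w2 * (w1 * u1 + w2 * u2) + w1 * (- w2 * u1 + w1 * u2)); first by ring.
  by rewrite e1 e2; ring.
by rewrite (mulfI nz E1) (mulfI nz E2).
Qed.

Lemma mcoeffM f g w : (f * g)@_w =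
  \sum_(u <- msupp f) \sum_(v <- msupp g) f@_u * g@_v *+ (u + v == w).
Proof.
rewrite [f * g]/(lmul f g) /lmul raddf_sum; apply: eq_bigr => u _.
by rewrite raddf_sum; apply: eq_bigr => v _; rewrite /= mcoeffU.
Qed.

Lemma msuppM f g w : w \in msupp (f * g) ->
  exists u v, [/\ u \in msupp f, v \in msupp g & w = u + v].
Proof.
rewrite -mcoeff_neq0 mcoeffM => fg0.
have [/hasP[u uf /hasP[v vg /eqP <-]]|/hasPn nsum] :=
  boolP (has (fun u => has (fun v => u + v == w) (msupp g)) (msupp f)).
  by exists u, v.
case/eqP: fg0; rewrite big_seq big1 // => u /nsum/hasPn nuv.
by rewrite big_seq big1 // => v /nuv /negPf ->.
Qed.

Lemma msupp_neq0 f : f != 0 -> exists u, u \in msupp f.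
Proof.
move=> /eqP f0; apply/fset0Pn/negP => /eqP s0; apply: f0.
by apply: (malgP f 0).1 => u; rewrite mcoeff0 mcoeff_outdom // s0 inE.
Qed.

Lemma exists_maximum (T : eqType) (F : T -> int) (x0 : T) (s : seq T) :
  x0 \in s -> exists2 x, x \in s & {in s, forall y, F y <= F x}.
Proof.
elim: s x0 => // x [|y s] IHs x0 _.
  by exists x; rewrite ?mem_head // => y /[1!inE] /eqP ->.
have [|z zs maxz] := IHs y; first exact: mem_head.
have [zx|xz] := lerP (F z) (F x).
  exists x; rewrite ?mem_head // => t; rewrite inE => /orP[/eqP-> //|/maxz].
  by move/le_trans; apply.
exists z; [by rewrite inE zs orbT | move=> t; rewrite inE => /orP[/eqP->|/maxz //]].
exact: ltW.
Qed.

Lemma exists_lex_maximum w w' f : f != 0 -> exists2 u, u \in msupp f &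
  {in msupp f, forall v, dot w v <= dot w u /\
    (dot w v = dot w u -> dot w' v <= dot w' u)}.
Proof.
move=> /msupp_neq0[u0 u0f].
have [u uf maxu] := @exists_maximum _ (dot w) u0 (msupp f) u0f.
pose s := [seq v <- msupp f | dot w v == dot w u].
have us : u \in s by rewrite mem_filter eqxx.
have [v] := @exists_maximum _ (dot w') u s us.
rewrite mem_filter => /andP[/eqP vu vf] maxv; exists v => // t tf.
rewrite vu maxu //; split=> // tu; apply: maxv.
by rewrite mem_filter tf tu eqxx.
Qed.

(* The terms of f and g maximal for the lexicographic order given by w and a
   perpendicular direction have a product that does not cancel. *)
Lemma support_split w M f g : w != 0 -> f != 0 -> g != 0 ->
  {in msupp (f * g), forall u, dot w u <= M} ->
  exists M1 M2, [/\ {in msupp f, forall u, dot w u <= M1},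
    {in msupp g, forall u, dot w u <= M2} & M1 + M2 <= M].
Proof.
move=> w0 f0 g0 maxM.
have [u uf maxu] := exists_lex_maximum w (- w.2, w.1) f0.
have [v vg maxv] := exists_lex_maximum w (- w.2, w.1) g0.
exists (dot w u), (dot w v); split=> [t /maxu[]|t /maxv[]|] //.
rewrite -dotD; apply: maxM; rewrite -mcoeff_neq0 mcoeffM.
suff -> : \sum_(u' <- msupp f) \sum_(v' <- msupp g)
    f@_u' * g@_v' *+ (u' + v' == u + v) = f@_u * g@_v.
  by rewrite mulf_neq0 ?mcoeff_neq0.
have uniq_sum u' v' : u' \in msupp f -> v' \in msupp g ->
    u' + v' == u + v -> u' = u /\ v' = v.
  (* Two maxima can only add up to the value at u + v if both are attained; this applies first to w,
     then to the perpendicular direction. *)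
  move=> /maxu[le1 le1'] /maxv[le2 le2'] /eqP e.
  have := congr1 (dot w) e; have := congr1 (dot (- w.2, w.1)) e.
  rewrite !dotD => e2 e1.
  have eu : dot w u' = dot w u by lia.
  have ev : dot w v' = dot w v by lia.
  have {}le1' := le1' eu; have {}le2' := le2' ev.
  by split; apply: (dot_inj w0) => //; lia.
rewrite (bigD1_seq u) //= [X in _ + X]big1_seq ?addr0; last first.
  move=> u' /andP[u'u u'f]; apply: big1_seq => v' /andP[_ v'g].
  by case: eqP => // /eqP /(uniq_sum _ _ u'f v'g)[uu _]; rewrite uu eqxx in u'u.
rewrite (bigD1_seq v) //= eqxx [X in _ + X]big1_seq ?addr0 //.
move=> v' /andP[v'v v'g].
by case: eqP => // /eqP /(uniq_sum _ _ uf v'g)[_ vv]; rewrite vv eqxx in v'v.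
Qed.

End Supports.

(** * Triangles with apex on the left edge *)

Definition irange (z : int) (n : nat) : seq int := [seq z + j%:Z | j <- iota 0 n].

Lemma size_irange z n : size (irange z n) = n.
Proof. by rewrite size_map size_iota. Qed.

Lemma mem_irange z n x : (x \in irange z n) = (z <= x < z + n%:Z).
Proof.
apply/mapP/andP => [[j]|[zx xn]]; first by rewrite mem_iota => jn ->; lia.
by exists `|x - z|%N; rewrite ?mem_iota; lia.
Qed.

(** Kept over the integers, so that nonvanishing is decided there and carried to k by characteristic
    zero. *)
Definition root_prod (s : seq int) (z : int) : int := \prod_(x <- s) (z - x).

Lemma root_prod_eq0 s z : (root_prod s z == 0) = (z \in s).
Proof.
rewrite /root_prod; elim: s => [|x s IHs]; first by rewrite big_nil oner_eq0.
by rewrite big_cons mulf_eq0 inE IHs subr_eq0.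
Qed.

Lemma root_prod_mem s z : z \in s -> root_prod s z = 0.
Proof. by rewrite -root_prod_eq0 => /eqP. Qed.

(** Both sides are the product of z + 1 - z0 - j over 0 <= j <= n. *)
Lemma root_prod_shift z0 n z : root_prod (irange z0 n) (z + 1) * (z + 1 - z0 - n%:Z) =
  (z + 1 - z0) * root_prod (irange z0 n) z.
Proof.
rewrite /root_prod !big_map; elim: n => [|n IHn]; first by rewrite !big_nil; lia.
rewrite -addn1 iotaD !big_cat /= !big_seq1 add0n mulrA -IHn.
by rewrite !PoszD; ring.
Qed.

(** In this and the next two bounds D is d = 2 K - 5, so that a = D + 2 and b = D + 4. Here D y <= D
    x + 2 x < D (x + 1). *)
Lemma left_columns_bound (D x y : int) : 0 < D ->
  D * y <= (D + 2) * x -> 2 * x < D -> y <= x.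
Proof. move=> D0 yx xD. case: (lerP y x) => // xy.
have : D * (x+1) <= D * y by rewrite ler_pM2l //; lia.
lia. Qed.
(** The two edges meet at (p, t), the right one being steeper: eliminating y gives (D^2 + 2 D - 4)
    (x - p) <= 0. *)
Lemma last_columns (D x y p t : int) : 3 <= D -> D * t = (D + 2) * p ->
  D * y <= (D + 2) * x -> (D + 4) * (x - p) <= 2 * (y - t) -> p <= x ->
  x = p /\ y = t.
Proof.
move=> D3 tp yx xy px.
have xp : x = p.
  apply/eqP; rewrite eq_le px andbT -subr_le0.
  have : D * ((D + 4) * (x - p)) <= D * (2 * (y - t)) by rewrite ler_pM2l //; lia.
  rewrite -(pmulr_rle0 (x - p) (_ : 0 < D ^+ 2 + 2 * D - 4)); first by lia.
  by nia.
split=> //; move: yx xy; rewrite xp -tp ler_pM2l; lia.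
Qed.
Lemma last_but_one (D y p t : int) : 0 < D -> D * t = (D + 2) * p ->
  D * y <= (D + 2) * (p - 1) -> y <= t - 2.
Proof. move=> D0 tp yp; have : D * y < D * (t - 1) by lia.
rewrite ltr_pM2l //; lia. Qed.

(** * Moments against polynomials with prescribed integer roots *)

Section Tests.
Context {k : fieldType} (char0 : [pchar k] =i pred0).
Implicit Types (g : laurent k).

Definition root_poly (s : seq int) : {poly k} := \prod_(x <- s) ('X - (x%:~R)%:P).

Lemma size_root_poly s : size (root_poly s) = (size s).+1.
Proof. exact: size_prod_XsubC. Qed.

Lemma horner_root_poly s (z : int) : (root_poly s).[z%:~R] = (root_prod s z)%:~R.
Proof.
rewrite /root_poly horner_prod /root_prod rmorph_prod; apply: eq_bigr => x _.
by rewrite hornerXsubC -rmorphB.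
Qed.

Lemma vanishes_roots n g s s' : vanishes n g -> (size s + size s' < n)%N ->
  pairing (fun u => (root_prod s u.1 * root_prod s' u.2)%:~R) g = 0.
Proof.
move=> vg sn; have <- : pairing (fun u => (root_poly s).[u.1%:~R] *
    (root_poly s').[u.2%:~R]) g = 0.
  by apply: (vanishes_test char0 vg); rewrite !size_root_poly addSn addnS ltnS.
by apply: eq_bigr => u _; rewrite !horner_root_poly rmorphM.
Qed.

Lemma sum_single (P : pred (int * int)) (phi : int * int -> k) w g : P w ->
  {in msupp g, forall u, P u -> u != w -> phi u = 0} ->
  \sum_(u <- msupp g | P u) g@_u * phi u = g@_w * phi w.
Proof.
move=> Pw phi0; have [wg|wg] := boolP (w \in msupp g); last first.
  rewrite (mcoeff_outdom wg) mul0r; apply: big1_seq => u /andP[Pu ug].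
  by rewrite phi0 ?mulr0 //; apply: contraNneq wg => <-.
rewrite -big_filter (bigD1_seq w) ?mem_filter ?Pw ?filter_uniq ?fset_uniq //=.
rewrite big1_seq ?addr0 // => u /andP[uw]; rewrite mem_filter => /andP[Pu ug].
by rewrite phi0 ?mulr0.
Qed.

(** The polynomial with x-roots 0, ..., p - 1 has degree p and sees only the corner. *)
Lemma last_column_order (p : nat) (t : int) g :
  {in msupp g, forall u, [/\ 0 <= u.1, u.1 <= p%:Z & u.1 = p%:Z -> u = (p%:Z, t)]} ->
  g@_(p%:Z, t) != 0 -> ~ vanishes p.+1 g.
Proof.
move=> sg gp vg; have := vanishes_roots vg (s := irange 0 p) (s' := [::]).
rewrite size_irange /= => /(_ ltac:(lia)).
rewrite /pairing (sum_single (P := predT) (w := (p%:Z, t))) //.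
  move=> /eqP; rewrite mulf_eq0 (negPf gp) intr_eq0_char0 //.
  by rewrite mulf_eq0 !root_prod_eq0 mem_irange /= orbF; lia.
move=> u /sg[u0 up upt] _ uc; rewrite root_prod_mem ?mul0r // mem_irange.
have u1p : u.1 != p%:Z by apply: contraNneq uc => /upt ->.
by move: (u.1) u0 up u1p {upt} => x; lia.
Qed.

(** The e i have pairwise distinct degrees 0, ..., n - 1, so they span the polynomials of size at
    most n; leading terms are removed one by one. *)
Lemma poly_span (Phi : {poly k} -> k) (e : nat -> {poly k}) n :
  (forall c P Q, Phi (c *: P + Q) = c * Phi P + Phi Q) ->
  (forall i, (i < n)%N -> size (e i) = i.+1 /\ Phi (e i) = 0) ->
  forall P : {poly k}, (size P <= n)%N -> Phi P = 0.
Proof.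
move=> linPhi; elim: n => [|n IHn] e0 P.
  rewrite leqn0 size_poly_eq0 => /eqP ->.
  by have := linPhi (-1) 0 0; rewrite scaler0 addr0 mulN1r addNr.
have [size_e e_n] := e0 n (ltnSn n).
have lead_e : (e n)`_n != 0.
  have : lead_coef (e n) != 0 by rewrite lead_coef_eq0 -size_poly_eq0 size_e.
  by rewrite lead_coefE size_e.
move=> sP; pose c := P`_n / (e n)`_n.
rewrite -[P](subrKC (c *: e n)) linPhi e_n mulr0 add0r; apply: IHn.
  by move=> i i_n; apply: e0; apply: ltnW.
apply/leq_sizeP => j nj; rewrite coefB coefZ.
have [jn|jn] := eqVneq j n; first by rewrite jn /c divfK // subrr.
have nj' : (n < j)%N by rewrite ltn_neqAle eq_sym jn.
by rewrite !nth_default ?mulr0 ?subrr // ?size_e // (leq_trans sP).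
Qed.

(* The test polynomials of x-roots i, ..., p - 2 and y-roots 0, ..., i - 1 only
   see the last two columns, and express the i-th moment of column p - 1 by the
   corner coefficient.  Column p - 1 has at most K - 2 terms, so that a
   polynomial of degree K - 2 in y kills it. *)
Lemma lattice_triangle_corner (K p t : nat) g : (4 <= K)%N -> (0 < p)%N ->
  (2 * K%:Z - 5) * t%:Z = (2 * K%:Z - 3) * p%:Z ->
  {in msupp g, forall u, [/\ 0 <= u.2, (2 * K%:Z - 5) * u.2 <= (2 * K%:Z - 3) * u.1 &
    (2 * K%:Z - 1) * (u.1 - p%:Z) <= 2 * (u.2 - t%:Z)]} ->
  vanishes p g -> g@_(p%:Z, t%:Z) = 0.
Proof.
move=> K4 p0 tp supp_g vg; pose D : int := 2 * K%:Z - 5.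
have D3 : 3 <= D by rewrite /D; lia.
have {}tp : D * t%:Z = (D + 2) * p%:Z by rewrite /D; lia.
have {}supp_g : {in msupp g, forall u, [/\ 0 <= u.2, D * u.2 <= (D + 2) * u.1 &
    (D + 4) * (u.1 - p%:Z) <= 2 * (u.2 - t%:Z)]}.
  by move=> u /supp_g[? ? ?]; rewrite /D; split; lia.
(* D is odd, hence coprime to D + 2, so D divides p and p >= 2 K - 5 >= K - 1. This leaves room for
   the x-roots of all the tests below. *)
have Kp : (K.-1 <= p)%N.
  have : (2 * K - 5 %| (2 * K - 3) * p)%N.
    by apply/dvdnP; exists t; move: tp; rewrite /D; nia.
  rewrite Gauss_dvdr; last first.
    rewrite (_ : 2 * K - 3 = 2 + (2 * K - 5))%N; last by lia.
    by rewrite /coprime gcdnDr gcdnC -/(coprime _ _) coprime2n; lia.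
  by move/dvdn_leq => /(_ p0); lia.
(* Dividing the i-th test by its x-factor at p - 1 leaves (p - i) R (t) at the corner. As (t - i) R
   (t) = t R (t - 1), this equals (p - t) R (t) + t R (t - 1), a linear expression in R free of
   i. *)
pose Phi (R : {poly k}) := \sum_(u <- msupp g | u.1 == p%:Z - 1) g@_u * R.[u.2%:~R]
  + g@_(p%:Z, t%:Z) * ((p%:Z - t%:Z)%:~R * R.[t%:Z%:~R] + t%:Z%:~R * R.[(t%:Z - 1)%:~R]).
have linPhi c P Q : Phi (c *: P + Q) = c * Phi P + Phi Q.
  rewrite /Phi; under eq_bigr => u _ do rewrite hornerD hornerZ mulrDr mulrCA.
  by rewrite big_split /= -mulr_sumr !hornerD !hornerZ; ring.
have Phi0 i : (i < K.-1)%N -> size (root_poly (irange 0 i)) = i.+1 /\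
    Phi (root_poly (irange 0 i)) = 0.
  move=> iK; rewrite size_root_poly size_irange; split=> //.
  pose A := irange i%:Z (p.-1 - i); pose R := irange 0 i.
  have pA : root_prod A (p%:Z - 1) != 0 by rewrite root_prod_eq0 mem_irange; lia.
  have := @vanishes_roots p g A R vg; rewrite !size_irange => /(_ ltac:(lia)) test0.
  have /mulfI : (root_prod A (p%:Z - 1))%:~R != 0 :> k by rewrite intr_eq0_char0.
  apply; rewrite mulr0 -test0 /pairing (bigID (fun u => u.1 == p%:Z - 1)) /=.
  rewrite mulrDr mulr_sumr; congr (_ + _).
    apply: eq_bigr => u /eqP ->.
    by rewrite horner_root_poly rmorphM mulrCA.
  rewrite (sum_single (w := (p%:Z, t%:Z))) /=; first last.
  - move=> [x y] ug /= up uw; have /= [y0 yx xy] := supp_g _ ug.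
    have [xi|ix] := ltrP x i%:Z.
      have y_x : y <= x by apply: left_columns_bound yx _; rewrite /D; lia.
      by rewrite [root_prod R _]root_prod_mem ?mulr0 // mem_irange; lia.
    have [xp|px] := ltrP x (p%:Z - 1).
      by rewrite root_prod_mem ?mul0r // mem_irange; lia.
    have [|e1 e2] := last_columns D3 tp yx xy; first by lia.
    by rewrite e1 e2 eqxx in uw.
  - by lia.
  rewrite mulrCA !horner_root_poly; congr (_ * _).
  rewrite -!rmorphM -rmorphD -rmorphM /=; congr (_%:~R).
  have := root_prod_shift i%:Z (p.-1 - i) (p%:Z - 1).
  have := root_prod_shift 0 i (t%:Z - 1).
  rewrite -/A -/R !subrK subr0 => <-.
  rewrite (_ : p%:Z - i%:Z - (p.-1 - i)%N%:Z = 1) ?mulr1; last by lia.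
  by move=> ->; ring.
(* Column p - 1 lies within t - K + 1 <= y <= t - 2: the upper bound comes from the left edge, the
   lower one from the right edge. *)
pose R := irange (t%:Z - K%:Z + 1) (K - 2).
have := poly_span linPhi Phi0 (P := root_poly R); rewrite size_root_poly size_irange.
move=> /(_ ltac:(lia)); rewrite /Phi big1_seq ?add0r; last first.
  move=> [x y] /andP[/= /eqP -> ug]; have D0 : 0 < D by lia.
  have /= [_ yx] := supp_g _ ug; have {yx} ut2 := last_but_one D0 tp yx.
  move=> ut1; rewrite horner_root_poly root_prod_mem ?mulr0 //.
  by rewrite mem_irange; move: ut1; rewrite /D; lia.
rewrite !horner_root_poly -!rmorphM -rmorphD /= => /eqP.
rewrite mulf_eq0 => /orP[/eqP //|]; rewrite intr_eq0_char0 //.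
have := root_prod_shift (t%:Z - K%:Z + 1) (K - 2) (t%:Z - 1); rewrite -/R subrK.
have -> : t%:Z - (t%:Z - K%:Z + 1) - (K - 2)%N%:Z = 1 by lia.
have -> : t%:Z - (t%:Z - K%:Z + 1) = K%:Z - 1 by lia.
rewrite mulr1 => ->; rewrite mulrA -mulrDl mulf_eq0 root_prod_eq0 mem_irange.
(* Since R (t) = (K - 1) R (t - 1), this is the factor left at the corner; D times it is -p. *)
have -> : ((p%:Z - t%:Z) * (K%:Z - 1) + t%:Z == 0) = false.
  apply/negP => /eqP e; have : D * ((p%:Z - t%:Z) * (K%:Z - 1) + t%:Z) = - p%:Z.
    transitivity (D * p%:Z * (K%:Z - 1) + D * t%:Z * (2 - K%:Z)); first by ring.
    by rewrite tp /D; ring.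
  by rewrite e mulr0; lia.
by lia.
Qed.

End Tests.

(** * Powers of the maximal ideal *)

Lemma sumn_iota_rev n : sumn [seq (n - i)%N | i <- iota 0 n] = 'C(n.+1, 2).
Proof.
elim: n => // n IHn; rewrite binS bin1 -IHn /= -[1%N]addn0 iotaDl -map_comp addnC.
by congr addn; congr sumn; apply: eq_map => i /=; lia.
Qed.

Lemma expr_pair_split (A : comNzRingType) (x y : A) i l j j' :
  (j <= i)%N -> (j' <= l)%N ->
  x ^+ i * y ^+ l = x ^+ j * y ^+ j' * (x ^+ (i - j) * y ^+ (l - j')).
Proof. by move=> ji jl; rewrite mulrACA -!exprD !subnKC. Qed.

Lemma mulr_cancel_pair (A : comNzRingType) (x y z t : A) :
  z * t = 1 -> x * y = (x * z) * (y * t).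
Proof. by move=> zt; rewrite mulrACA zt mulr1. Qed.

Lemma mulr_suml_assoc (A : comNzRingType) (I : finType) (P F : I -> A) g :
  (\sum_i P i * F i) * g = \sum_i P i * (F i * g).
Proof. by rewrite mulr_suml; apply: eq_bigr => i _; rewrite mulrA. Qed.

(** Taylor expansion at 1. The bound B is free so that all monomials of a sum share one range;
    binomial coefficients beyond n are 0. *)
Lemma expr_sub1 (A : comNzRingType) (z : A) (B n : nat) : (n < B)%N ->
  z ^+ n = \sum_(i < B) (z - 1) ^+ i *+ 'C(n, i).
Proof.
move=> nB; rewrite -{1}[z](subrK 1) exprD1n.
rewrite (big_ord_widen_cond B predT (fun i => (z - 1) ^+ i *+ 'C(n, i))) //.
rewrite [RHS](bigID (fun i : 'I_B => (i < n.+1)%N)) /= [X in _ = _ + X]big1 ?addr0 //.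
by move=> i; rewrite -leqNgt => ni; rewrite bin_small.
Qed.

Lemma monomial_taylor (A : comNzRingType) (c x y : A) (B p q : nat) :
  (p < B)%N -> (q < B)%N -> c * (x ^+ p * y ^+ q) = \sum_(i < B) \sum_(l < B)
    (x - 1) ^+ i * (y - 1) ^+ l * (c *+ ('C(p, i) * 'C(q, l))).
Proof.
move=> pB qB; rewrite (expr_sub1 x pB) (expr_sub1 y qB) mulr_suml mulr_sumr.
apply: eq_bigr => i _; rewrite !mulr_sumr; apply: eq_bigr => l _.
by rewrite mulrnAl !mulrnAr -mulrnA mulnC mulrC.
Qed.

Section IdealPowers.
Context {k : fieldType}.
Implicit Types (f g : laurent k).

Lemma in_max_ideal_powD n f g : in_max_ideal_pow n f -> in_max_ideal_pow n g ->
  in_max_ideal_pow n (f + g).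
Proof.
move=> [F ->] [G ->]; exists (fun i => F i + G i).
by rewrite -big_split; apply: eq_bigr => i _; rewrite mulrDr.
Qed.

Lemma in_max_ideal_powM n f g : in_max_ideal_pow n f -> in_max_ideal_pow n (f * g).
Proof.
move=> [F ->]; exists (fun i => F i * g); exact: mulr_suml_assoc.
Qed.

Lemma in_max_ideal_pow0 n : in_max_ideal_pow n (0 : laurent k).
Proof. by exists (fun=> 0); rewrite big1 // => i _; rewrite mulr0. Qed.

Lemma in_max_ideal_pow_sum n (I : Type) (r : seq I) (F : I -> laurent k) :
  (forall i, in_max_ideal_pow n (F i)) -> in_max_ideal_pow n (\sum_(i <- r) F i).
Proof.
move=> nF; elim/big_rec: _ => [|i g _ ng]; first exact: in_max_ideal_pow0.
exact: in_max_ideal_powD.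
Qed.

Lemma in_max_ideal_pow_monomial n i l : (n <= i + l)%N ->
  in_max_ideal_pow n ((lX - 1) ^+ i * (lY - 1) ^+ l : laurent k).
Proof.
move=> nil; pose j := minn i n; have jn : (j < n.+1)%N by rewrite /j; lia.
exists (fun j' => if j' == Ordinal jn then
   (lX - 1) ^+ (i - j) * (lY - 1) ^+ (l - (n - j)) else 0).
rewrite (bigD1 (Ordinal jn)) //= eqxx big1 ?addr0; last first.
  by move=> j' /negPf ->; rewrite mulr0.
by apply: expr_pair_split; rewrite /j; lia.
Qed.

Lemma lXn n : (lX : laurent k) ^+ n = << 1 *g (n%:Z, 0) >>.
Proof.
elim: n => [|n IHn]; first exact: expr0.
rewrite exprS IHn; apply: etrans (lmulUU _ _ _ _) _.
by rewrite mulr1; congr (<< _ *g _ >>); congr pair; lia.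
Qed.

Lemma lYn n : (lY : laurent k) ^+ n = << 1 *g (0, n%:Z) >>.
Proof.
elim: n => [|n IHn]; first exact: expr0.
rewrite exprS IHn; apply: etrans (lmulUU _ _ _ _) _.
by rewrite mulr1; congr (<< _ *g _ >>); congr pair; lia.
Qed.

Definition lC c : laurent k := << c *g (0 : int * int) >>.

Lemma malgU_lXlY c (x y : nat) : (<< c *g (x%:Z, y%:Z) >> : laurent k) =
  lC c * (lX ^+ x * lY ^+ y).
Proof.
rewrite lXn lYn; apply/esym; rewrite [X in _ * X]lmulUU; apply: etrans (lmulUU _ _ _ _) _.
by rewrite !mulr1 add0r -[(_, _) + _]/(x%:Z + 0, 0 + y%:Z) addr0 add0r.
Qed.

Definition nat_point (u : nat * nat) : int * int := (u.1%:Z, u.2%:Z).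

Lemma nat_point_inj : injective nat_point.
Proof. by case=> x y [x' y'] [-> ->]. Qed.

(** The sums assumed to be zero are the Taylor coefficients at (1, 1) of degree below n. Exponents
    are natural numbers, which keeps the expansion finite. *)
Lemma taylor_in_max_ideal_pow n (I : finType) (c : I -> k) (s : I -> nat * nat) :
  (forall i l, (i + l < n)%N ->
    \sum_j c j * ('C((s j).1, i) * 'C((s j).2, l))%:R = 0) ->
  in_max_ideal_pow n (\sum_j << c j *g nat_point (s j) >> : laurent k).
Proof.
move=> taylor0; pose B := (\max_j maxn (s j).1 (s j).2).+1.
have sB j : ((s j).1 < B)%N && ((s j).2 < B)%N.
  by have := leq_bigmax (F := fun j => maxn (s j).1 (s j).2) j; rewrite /B; lia.
pose C i l := \sum_j c j * ('C((s j).1, i) * 'C((s j).2, l))%:R.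
have -> : \sum_j << c j *g nat_point (s j) >> = \sum_(i < B) \sum_(l < B)
    (lX - 1) ^+ i * (lY - 1) ^+ l * lC (C i l) :> laurent k.
  transitivity (\sum_j \sum_(i < B) \sum_(l < B) (lX - 1) ^+ i * (lY - 1) ^+ l *
      lC (c j * ('C((s j).1, i) * 'C((s j).2, l))%:R)).
    apply: eq_bigr => j _; have /andP[s1 s2] := sB j.
    rewrite /nat_point malgU_lXlY (monomial_taylor _ _ _ s1 s2).
    apply: eq_bigr => i _; apply: eq_bigr => l _; congr (_ * _).
    by rewrite /lC mulr_natr monalgUMn.
  rewrite exchange_big; apply: eq_bigr => i _; rewrite exchange_big.
  apply: eq_bigr => l _; rewrite -mulr_sumr /C; congr (_ * _).
  by rewrite /lC raddf_sum.
apply: in_max_ideal_pow_sum => i; apply: in_max_ideal_pow_sum => l.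
have [iln|nil] := ltnP (i + l) n.
  rewrite [C i l]taylor0 // /lC monalgU0 mulr0; exact: in_max_ideal_pow0.
by apply: in_max_ideal_powM; apply: in_max_ideal_pow_monomial.
Qed.

(** There is one linear condition for each pair (i, l) with i + l < n; with more points than
    conditions, the condition matrix has a nonzero left kernel. *)
Lemma exists_in_max_ideal_pow n (s : seq (nat * nat)) : uniq s ->
  ('C(n.+1, 2) < size s)%N -> exists f : laurent k,
  [/\ f != 0, {in msupp f, forall u, exists2 v, v \in s & u = nat_point v} &
     in_max_ideal_pow n f].
Proof.
move=> uniq_s s_large.
pose conds := [seq (i, l) | i <- iota 0 n, l <- iota 0 (n - i)].
have size_conds : size conds = 'C(n.+1, 2).
  rewrite size_allpairs_dep; under eq_map => i do rewrite size_iota.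
  exact: sumn_iota_rev.
pose pt i := nth (0, 0)%N s i.
pose M : 'M[k]_(size s, size conds) := \matrix_(i, j)
  ('C((pt i).1, (nth (0, 0)%N conds j).1) * 'C((pt i).2, (nth (0, 0)%N conds j).2))%:R.
have : kermx M != 0.
  rewrite kermx_eq0 /row_free neq_ltn (leq_ltn_trans (rank_leq_col M)) //.
  by rewrite size_conds.
case/rowV0Pn => c /sub_kermxP cM c0.
pose f : laurent k := \sum_(i < size s) << c 0 i *g nat_point (pt i) >>.
exists f; split.
- have /rV0Pn[i ci] := c0; apply: contraNneq ci => f0.
  have <- : f@_(nat_point (pt i)) = c 0 i; last by rewrite f0 mcoeff0.
  rewrite /f raddf_sum (bigD1 i) //= mcoeffUU big1 ?addr0 // => j ji.
  rewrite mcoeffU; case: eqP => // /nat_point_inj /eqP.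
  by rewrite /pt nth_uniq // => /eqP /val_inj /eqP; rewrite (negPf ji).
- move=> u; rewrite -mcoeff_neq0 /f raddf_sum /= => fu.
  have [/existsP[i /eqP ui]|/existsPn nu] := boolP [exists i : 'I_(size s), nat_point (pt i) == u].
    by exists (pt i); rewrite ?mem_nth.
  by case/eqP: fu; apply: big1 => i _; rewrite mcoeffU (negPf (nu i)).
apply: taylor_in_max_ideal_pow => i l iln.
have il_conds : (i, l) \in conds.
  by apply/allpairsPdep; exists i, l; rewrite !mem_iota; split => //; lia.
have jlt : (index (i, l) conds < size conds)%N by rewrite index_mem.
have /matrixP/(_ 0 (Ordinal jlt)) := cM; rewrite !mxE => cM0; rewrite -[RHS]cM0.
by apply: eq_bigr => j _; rewrite mxE /= nth_index.
Qed.

End IdealPowers.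

(** * The lattice triangle of the theorem *)

Lemma divn_interval (q n d : nat) : (q * d <= n < q.+1 * d)%N -> (n %/ d = q)%N.
Proof.
move=> /andP[qn nq]; have d0 : (0 < d)%N by case: d nq {qn} => //; lia.
by apply/eqP; rewrite eqn_leq -ltnS ltn_divLR // leq_divRL // nq qn.
Qed.
(** Write 2 v - 2 + e = q (D + 2) + r with r < D + 2. If r < D, the column x = v - 1 - q runs from 0
    to x + q. If r >= D, the column x = m - q - 1 runs from h - q - 1 - v to h - q - 2. *)
Lemma colsize_cover (D e m h v : nat) : odd D -> (3 <= D)%N -> (e <= 1)%N ->
  (2 * (2 * m + e) = D * (D + 3))%N -> (2 * (2 * h + e) = (D + 2) * (D + 3))%N ->
  (D * h = (D + 2) * m + e)%N -> (1 <= v <= m)%N -> exists2 x, (x < m)%N &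
  ((((D + 2) * x + e) %/ D).+1 - (2 * h + e - (D + 4) * (m - x)) %/ 2 = v)%N.
Proof.
move=> oD D3 e1 mD hD dhD /andP[v0 vm].
have := divn_eq (2 * v - 2 + e) (D + 2).
have := ltn_pmod (2 * v - 2 + e) (_ : 0 < D + 2)%N; rewrite addn_gt0 orbT => /(_ isT).
move: (_ %/ _)%N (_ %% _)%N => q r rD E.
have qD : (2 * q < D)%N.
  rewrite ltnNge; apply/negP => Dq.
  have : ((D + 1) * (D + 2) <= 2 * q * (D + 2))%N by rewrite leq_mul2r; lia.
  lia.
have [rlt|rge] := ltnP r D.
  have qv : (q < v)%N.
    rewrite ltnNge; apply/negP => vq.
    have : (v * (D + 2) <= q * (D + 2))%N by rewrite leq_mul2r; lia.
    have : (v * 5 <= v * (D + 2))%N by rewrite leq_mul2l; lia.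
    lia.
  pose x := (v - 1 - q)%N; have xE : (2 * x + e = q * D + r)%N by rewrite /x; lia.
  exists x; first by rewrite /x; lia.
  have -> : (((D + 2) * x + e) %/ D = x + q)%N.
    by apply: divn_interval; lia.
  have qD2 : (q * D <= D * D)%N by rewrite mulnC leq_mul2l; lia.
  have le1 : (2 * h + e - (D + 4) * (m - x) <= 1)%N.
    have mx : (D + 1 <= 2 * (m - x))%N.
      have : (2 * q * D <= (D - 1) * D)%N by rewrite leq_mul2r; lia.
      have : ((D - 1) * D = D * D - D)%N by rewrite mulnBl mul1n.
      lia.
    have : ((D + 4) * (D + 1) <= (D + 4) * (2 * (m - x)))%N by rewrite leq_mul2l mx orbT.
    lia.
  rewrite divn_small ?ltnS // subn0 /x; lia.
have qD2 : (2 * q + 2 <= D)%N.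
  rewrite leqNgt; apply/negP => Dq; have Dq' : (D <= 2 * q + 1)%N by lia.
  have : (D * (D + 2) <= (2 * q + 1) * (D + 2))%N by rewrite leq_mul2r; lia.
  lia.
have D3D : (D * 3 <= D * D)%N by rewrite leq_mul2l D3 orbT.
have qm : (q.+1 <= m)%N by lia.
exists (m - q.+1)%N; first by lia.
rewrite subKn //.
have mq : ((D + 2) * (m - q.+1) = (D + 2) * m - (D + 2) * q.+1)%N by rewrite mulnBr.
have hq : (q.+2 <= h)%N by lia.
have hqE : ((h - q.+2) * D = h * D - q.+2 * D)%N by rewrite mulnBl.
have hqE' : (q.+2 * D <= h * D)%N by rewrite leq_mul2r hq orbT.
have mqE' : ((D + 2) * q.+1 <= (D + 2) * m)%N by rewrite leq_mul2l qm orbT.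
have -> : (((D + 2) * (m - q.+1) + e) %/ D = h - q.+2)%N.
  by apply: divn_interval; rewrite mulSn mq hqE; lia.
have -> : ((2 * h + e - (D + 4) * q.+1) %/ 2 = h - q.+1 - v)%N.
  by apply: divn_interval; lia.
by lia.
Qed.

(** Eliminating y from the two edges gives (D^2 + 2 D - 4) (x - m) <= D (1 - e), which fails once x
    - m >= 1. *)
Lemma le_last_column (D x y m h e : int) : 3 <= D -> 0 <= e -> D * h = (D + 2) * m + e ->
  D * y <= (D + 2) * x + e -> (D + 4) * (x - m) <= 2 * (y - h) + (1 - e) -> x <= m.
Proof.
move=> D3 e0 dh yx xy; rewrite leNgt; apply/negP => mx.
have : D * ((D + 4) * (x - m)) <= D * (2 * (y - h) + (1 - e)) by rewrite ler_pM2l //; lia.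
have : (D ^+ 2 + D - 4) * 1 <= (D ^+ 2 + D - 4) * (x - m).
  by rewrite ler_pM2l; nia.
nia.
Qed.


Section Columns.
(* The lattice triangle of the theorem: e = 1 for even K, e = 0 for odd K, and
   (m, h) is the only lattice point of the last column. *)
Variables (K e m h : nat).
Hypotheses (K4 : (4 <= K)%N) (e1 : (e <= 1)%N)
  (em : (2 * m + e = (2 * K - 5) * (K - 1))%N)
  (eh : (2 * h + e = (2 * K - 3) * (K - 1))%N).

Definition in_region (u : int * int) := [/\ 0 <= u.2,
  (2 * K%:Z - 5) * u.2 <= (2 * K%:Z - 3) * u.1 + e%:Z &
  (2 * K%:Z - 1) * (u.1 - m%:Z) <= 2 * (u.2 - h%:Z) + (1 - e%:Z)].

Definition top x := (((2 * K - 3) * x + e) %/ (2 * K - 5))%N.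
(** The right edge reads 2 y >= 2 h - (1 - e) - b (m - x); halving rounds up, and truncated
    subtraction supplies 0 <= y. *)
Definition bottom x := ((2 * h + e - (2 * K - 1) * (m - x)) %/ 2)%N.
Definition colsize x := ((top x).+1 - bottom x)%N.

Lemma dh_am : ((2 * K - 5) * h = (2 * K - 3) * m + e)%N.
Proof. nia. Qed.

Lemma region_ge0 u : in_region u -> 0 <= u.1.
Proof.
case: u => x y [/= y0 yx _]; rewrite leNgt; apply/negP => x0.
have : 0 <= (2 * K%:Z - 5) * y by rewrite mulr_ge0 //; lia.
have : (2 * K%:Z - 3) * x <= (2 * K%:Z - 3) * (-1) by rewrite ler_pM2l; lia.
lia.
Qed.

Lemma region_le_m u : in_region u -> u.1 <= m%:Z.
Proof.
case: u => x y [/= _ yx xy].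
apply: (@le_last_column (2 * K%:Z - 5) x y m%:Z h%:Z e%:Z); lia.
Qed.

Lemma region_column u : in_region u -> exists x y : nat,
  [/\ u = nat_point (x, y), (x <= m)%N & (bottom x <= y < bottom x + colsize x)%N].
Proof.
move=> ru; have := region_ge0 ru; have := region_le_m ru.
case: u ru => [[x|x] [y|y]] [/= y0 yx xy] xm x0 //.
have {}xm : (x <= m)%N by lia.
exists x, y; split => //; rewrite /colsize.
have byx : (bottom x <= y)%N.
  rewrite /bottom; have := erefl ((2 * K - 1) * (m - x))%N.
  move: {2 3}((2 * K - 1) * (m - x))%N => z zE; have : (2 * K%:Z - 1) * (m%:Z - x%:Z) = z%:Z.
    rewrite -zE PoszM; congr (_ * _); lia.
  lia.
have : (y <= top x)%N by rewrite /top leq_divRL; lia.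
by rewrite byx; lia.
Qed.

Lemma column_region x y : (x <= m)%N -> (bottom x <= y < bottom x + colsize x)%N ->
  in_region (nat_point (x, y)).
Proof.
move=> xm /andP[byx yt]; have {yt} : (y <= top x)%N by rewrite /colsize in yt; lia.
rewrite /top leq_divRL; last by lia.
move=> yt; split => /=; [by [] | by lia |].
move: byx; rewrite /bottom; have := erefl ((2 * K - 1) * (m - x))%N.
move: {2 3}((2 * K - 1) * (m - x))%N => z zE; have : (2 * K%:Z - 1) * (m%:Z - x%:Z) = z%:Z.
  rewrite -zE PoszM; congr (_ * _); lia.
lia.
Qed.

Lemma bottom_m : bottom m = h.
Proof. by rewrite /bottom subnn; lia. Qed.

Lemma colsize_m : colsize m = 1%N.
Proof. by rewrite /colsize bottom_m /top -dh_am mulKn ?subSnn; lia. Qed.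

Lemma colsize_surj v : (1 <= v <= m)%N -> exists2 x, (x < m)%N & colsize x = v.
Proof.
move=> vm; rewrite /colsize /top /bottom.
have aD : (2 * K - 3 = 2 * K - 5 + 2)%N by lia.
have bD : (2 * K - 1 = 2 * K - 5 + 4)%N by lia.
rewrite aD bD; apply: colsize_cover => //; lia.
Qed.

(** The m sizes are all attained by m columns, hence each exactly once. *)
Lemma perm_colsize : perm_eq [seq colsize x | x <- iota 0 m] (iota 1 m).
Proof.
have sub : {subset iota 1 m <= [seq colsize x | x <- iota 0 m]}.
  move=> v; rewrite mem_iota => vm; have [|x xm <-] := @colsize_surj v; first by lia.
  by apply: map_f; rewrite mem_iota.
have sizes : size [seq colsize x | x <- iota 0 m] = size (iota 1 m).
  by rewrite size_map !size_iota.
rewrite perm_sym; apply: uniq_perm; first exact: iota_uniq.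
  by apply: leq_size_uniq sub _; rewrite ?iota_uniq ?sizes.
by have [] := uniq_min_size (iota_uniq 1 m) sub; rewrite ?sizes.
Qed.

Lemma count_colsize v : (0 < v)%N ->
  count (fun x => v <= colsize x)%N (iota 0 m) = (m.+1 - v)%N.
Proof.
move=> v0; rewrite -(count_map colsize (leq v)) (permP perm_colsize).
move: m => n; elim: n => [|n IHn]; first by case: v v0.
by rewrite -[in iota _ _](addn1 n) iotaD count_cat IHn /=; lia.
Qed.

Definition region_points :=
  [seq (x, y) | x <- iota 0 m.+1, y <- iota (bottom x) (colsize x)].

Lemma region_points_uniq : uniq region_points.
Proof.
apply: allpairs_uniq_dep; [exact: iota_uniq | by move=> *; apply: iota_uniq |].
by move=> [x y] [x' y'] _ _ /= [-> ->].
Qed.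

Lemma size_region_points : size region_points = 'C(m.+1, 2).+1.
Proof.
rewrite size_allpairs_dep; under eq_map => x do rewrite size_iota.
rewrite -[in iota _ _](addn1 m) iotaD map_cat sumn_cat /= add0n colsize_m addn0 addn1.
congr _.+1; rewrite (perm_sumn perm_colsize) -triangular_sum sumnE.
by rewrite big_ltn // add0n /index_iota subSS subn0.
Qed.

Lemma region_first_column u : in_region u -> u.1 = 0 -> u = (0, 0).
Proof.
case: u => x y [/= y0 yx _] x0; rewrite x0 in yx *; congr pair.
apply/eqP; rewrite eq_le y0 andbT leNgt; apply/negP => y1.
have : (2 * K%:Z - 5) * 1 <= (2 * K%:Z - 5) * y by rewrite ler_pM2l; lia.
by lia.
Qed.

Lemma region_last_column u : in_region u -> u.1 = m%:Z -> u = (m%:Z, h%:Z).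
Proof.
move=> /region_column[x [y [-> /= _ +]]] [xm]; rewrite xm.
by rewrite bottom_m colsize_m addn1 ltnS -eqn_leq => /eqP <-.
Qed.

Context {k : fieldType} (char0 : [pchar k] =i pred0).
Implicit Types (f g : laurent k).

(* Columns vanish in order of size: a point of a column with v terms is isolated
   by roots at the m - v other columns with at least v terms and at the v - 1
   other points of its column. *)
Lemma region_curve_eq0 f : {in msupp f, forall u, in_region u} -> vanishes m f ->
  f@_(m%:Z, h%:Z) = 0 -> f = 0.
Proof.
move=> rf vf fc0.
have col0 v : (v <= m)%N -> forall x y : nat, (x < m)%N -> (colsize x <= v)%N ->
    f@_(nat_point (x, y)) = 0.
  elim: v => [_|v IHv vm] x y xm xv.
    apply: mcoeff_outdom; apply/negP => /rf /region_column.
    by move=> [x' [y' [/nat_point_inj[<- <-] _]]]; lia.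
  have [xv'|vx] := leqP (colsize x) v; first exact: IHv (ltnW vm) _ _ _ xv'.
  have {vx} xv : colsize x = v.+1 by lia.
  apply/eqP/negPn/negP; rewrite mcoeff_neq0 => xyf.
  have /region_column [x' [y' [/nat_point_inj[<- <-] _ xy]]] := rf _ xyf.
  pose large := [seq x' <- iota 0 m | v < colsize x']%N.
  have uniq_large : uniq large by rewrite filter_uniq // iota_uniq.
  pose s := [seq x'%:Z | x' <- rem x large].
  pose s' := rem y%:Z (irange (bottom x)%:Z v.+1).
  have ys' : y%:Z \in irange (bottom x)%:Z v.+1 by rewrite mem_irange; lia.
  have size_s' : size s' = v by rewrite size_rem // size_irange.
  have size_s : size s = (m - v).-1.
    rewrite size_map size_rem ?size_filter ?count_colsize //.
    by rewrite mem_filter mem_iota xv ltnSn.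
  have := vanishes_roots char0 vf (s := s) (s' := s').
  rewrite size_s size_s' => /(_ ltac:(lia)).
  rewrite /pairing (sum_single (P := predT) (w := nat_point (x, y))) //.
    move=> /eqP; rewrite mulf_eq0 mcoeff_eq0 xyf /=.
    rewrite intr_eq0_char0 // mulf_eq0 !root_prod_eq0 /= => /orP[/mapP[x2]|].
      by rewrite mem_rem_uniq // !inE => /andP[/negP + _] => + [/esym/eqP].
    by rewrite mem_rem_uniq ?inE ?eqxx // map_inj_uniq ?iota_uniq // => i j /addrI[].
  move=> u uf _ uxy; have ru := rf u uf.
  have [x2 [y2 [ue x2m y2b]]] := region_column ru.
  have [x2x|x2x] := eqVneq x2 x.
    rewrite [X in _ * X]root_prod_mem ?mulr0 // ue /= /s' rem_filter; last first.
      by rewrite map_inj_uniq ?iota_uniq // => i j /addrI[].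
    rewrite mem_filter mem_irange /= -xv -x2x; apply/andP; split; last by lia.
    by apply: contraNneq uxy => -[y2y]; rewrite ue x2x y2y.
  have [x2m'|x2m'] := eqVneq x2 m.
    move: uf; rewrite (region_last_column ru) ?ue ?x2m' //.
    by rewrite -mcoeff_neq0 fc0 eqxx.
  have {}x2m : (x2 < m)%N by rewrite ltn_neqAle x2m'.
  have [x2v|vx2] := leqP (colsize x2) v.
    by move: uf; rewrite ue -mcoeff_neq0 (IHv (ltnW vm)) ?eqxx.
  rewrite root_prod_mem ?mul0r // ue /=; apply/mapP; exists x2 => //.
  by rewrite mem_rem_uniq // !inE x2x mem_filter vx2 mem_iota.
have [//|/msupp_neq0[u uf]] := eqVneq f 0.
have ru := rf u uf; have [x [y [ue xm xy]]] := region_column ru.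
have [xm'|xm'] := eqVneq x m.
  move: uf; rewrite (region_last_column ru) ?ue ?xm' //.
  by rewrite -mcoeff_neq0 fc0 eqxx.
have xm2 : (x < m)%N by rewrite ltn_neqAle xm'.
move: uf; rewrite ue -mcoeff_neq0 (col0 m) ?eqxx //.
have /perm_mem/(_ (colsize x)) := perm_colsize.
by rewrite map_f ?mem_iota // => /esym; lia.
Qed.

Lemma m_gt1 : (1 < m)%N. Proof. nia. Qed.

(** * Corner, origin and order of a curve in the region *)

Section Curve.
Variable f : laurent k.
Hypotheses (f0 : f != 0) (rf : {in msupp f, forall u, in_region u}) (vf : vanishes m f).

Lemma region_curve_corner : f@_(m%:Z, h%:Z) != 0.
Proof. by apply: contraNneq f0 => fc0; rewrite (region_curve_eq0 rf vf fc0). Qed.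

(** The test with x-roots 1, ..., m - 1 sees only the origin and the corner (m, h), so the two
    coefficients vanish together. *)
Lemma region_curve_origin : f@_(0, 0) != 0.
Proof.
apply: contraNneq region_curve_corner => fo0; have m1 := m_gt1.
have := vanishes_roots char0 vf (s := irange 1 m.-1) (s' := [::]).
rewrite size_irange /= => /(_ ltac:(lia)).
rewrite /pairing (sum_single (P := predT) (w := (m%:Z, h%:Z))) //.
  move=> /eqP; rewrite mulf_eq0 intr_eq0_char0 // mulf_eq0 !root_prod_eq0 mem_irange /=.
  by rewrite orbF => /orP[/eqP //|]; lia.
move=> u uf _ uc; have ru := rf uf; have u1 := region_ge0 ru; have um := region_le_m ru.
rewrite root_prod_mem ?mul0r // mem_irange.
have u10 : u.1 != 0.
  by apply: contraTneq uf => u10; rewrite (region_first_column ru u10) -mcoeff_neq0 fo0 eqxx.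
have u1m : u.1 != m%:Z by apply: contraNneq uc => u1m; rewrite (region_last_column ru u1m).
by move: (u.1) u1 um u10 u1m => x; lia.
Qed.

Lemma region_curve_order : ~ vanishes m.+1 f.
Proof.
apply: (last_column_order char0 (t := h%:Z)) region_curve_corner => u /rf ru.
by split; [exact: region_ge0 | exact: region_le_m | exact: region_last_column].
Qed.

End Curve.

Lemma exists_region_curve : exists f : laurent k,
  [/\ f != 0, {in msupp f, forall u, in_region u} & in_max_ideal_pow m f].
Proof.
have [|f [f0 sf If]] := exists_in_max_ideal_pow (k := k) (n := m) region_points_uniq.
  by rewrite size_region_points.
exists f; split=> // u /sf[[x y] /allpairsPdep[x' [y' []]]].
rewrite !mem_iota => xm yb [-> ->] ->; apply: column_region; lia.
Qed.

Lemma mcoeffMU g c v w : (g * (<< c *g v >> : laurent k))@_(w + v) = g@_w * c.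
Proof.
rewrite mulrC; apply: etrans (congr1 (mcoeff _) (lmulU _ _ _)) _.
rewrite raddf_sum /=; under eq_bigr => u _ do rewrite mcoeffU mulrC -mulrnAr.
rewrite (sum_single (P := predT) (w := w)) // => [|u _ _ uw].
  by rewrite addrC eqxx.
by rewrite addrC (inj_eq (addIr v)) (negPf uw).
Qed.

Lemma is_unit_monomial c u : c != 0 -> is_unit (<< c *g u >> : laurent k).
Proof.
move=> c0; exists << c^-1 *g - u >>; apply: etrans (lmulUU _ _ _ _) _.
by rewrite mulfV // subrr.
Qed.

(* The case e = 0 of the region, with apex (p, t) on the left edge. *)
Lemma apex_factor_unit (p t : nat) g :
  (2 * K%:Z - 5) * t%:Z = (2 * K%:Z - 3) * p%:Z ->
  {in msupp g, forall u, [/\ 0 <= u.2, (2 * K%:Z - 5) * u.2 <= (2 * K%:Z - 3) * u.1 &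
    (2 * K%:Z - 1) * (u.1 - p%:Z) <= 2 * (u.2 - t%:Z)]} ->
  vanishes p g -> g@_(p%:Z, t%:Z) != 0 -> is_unit g.
Proof.
move=> tp sg vg gp; have [p0|p0] := posnP p; last first.
  by rewrite (lattice_triangle_corner char0 K4 p0 tp sg vg) eqxx in gp.
rewrite {p}p0 in tp sg vg gp; have t0 : t = 0%N by nia.
rewrite {t}t0 in tp sg gp.
suff -> : g = << g@_(0, 0) *g 0 >> by apply: is_unit_monomial.
apply: (malgP _ _).1 => u; rewrite mcoeffU.
have [<- //|u0] := eqVneq.
rewrite mulr0n; apply: mcoeff_outdom; apply: contra u0 => /sg.
case: u => x y /= [y0 yx xy]; have D0 : 3 <= 2 * K%:Z - 5 by lia.
have x0 : 0 <= x.
  rewrite leNgt; apply/negP => x0; have : 0 <= (2 * K%:Z - 5) * y by rewrite mulr_ge0 //; lia.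
  have : (2 * K%:Z - 3) * x <= (2 * K%:Z - 3) * (-1) by rewrite ler_pM2l; lia.
  by lia.
have [||||-> ->] // := @last_columns (2 * K%:Z - 5) x y 0 0 D0; lia.
Qed.

(** * Factorizations of the curve *)

Section Factors.
Variables (f g g' : laurent k).
Hypotheses (rf : {in msupp f, forall u, in_region u}) (vf : vanishes m f).
Hypotheses (fc : f@_(m%:Z, h%:Z) != 0) (fgg : f = g * g').
Hypotheses (g0 : g@_(0, 0) != 0) (g0' : g'@_(0, 0) != 0).

Lemma support_split_f w M : w != 0 -> {in msupp f, forall u, dot w u <= M} ->
  exists M1 M2, [/\ {in msupp g, forall u, dot w u <= M1},
    {in msupp g', forall u, dot w u <= M2}, M1 + M2 <= M, 0 <= M1 & 0 <= M2].
Proof.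
have gn0 : g != 0 by apply: contraNneq g0 => ->; rewrite mcoeff0.
have gn0' : g' != 0 by apply: contraNneq g0' => ->; rewrite mcoeff0.
rewrite fgg => w0 /(support_split w0 gn0 gn0')[M1 [M2 [sg sg' M12]]].
have dot0 : dot w 0 = 0 by rewrite /dot !mulr0.
exists M1, M2; split=> //; rewrite -dot0; [apply: sg | apply: sg'];
  by rewrite -mcoeff_neq0.
Qed.

Lemma region_factor_unit : is_unit g \/ is_unit g'.
Proof.
(* Support functions are split in five directions: left side, base, right side, left edge and right
   edge. *)
have [|l1 [l2 [gl gl' l12 l1_0 l2_0]]] := @support_split_f (-1, 0) 0 isT.
  by move=> u /rf /region_ge0; rewrite /dot /=; lia.
have [|b1 [b2 [gb gb' b12 b1_0 b2_0]]] := @support_split_f (0, -1) 0 isT.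
  by move=> u /rf []; rewrite /dot /=; lia.
have [|p [q [gp gq pq p0 q0]]] := @support_split_f (1, 0) m%:Z isT.
  by move=> u /rf /region_le_m; rewrite /dot /=; lia.
have [||M1 [M2 [gM gM' M12 M1_0 M2_0]]] := @support_split_f (- (2 * K%:Z - 3), 2 * K%:Z - 5) e%:Z.
- by rewrite xpair_eqE; lia.
- by move=> u /rf []; rewrite /dot /=; lia.
have [||B1 [B2 [gB gB' B12 B1_0 B2_0]]] := @support_split_f (2 * K%:Z - 1, - 2)
  ((2 * K%:Z - 1) * m%:Z - 2 * h%:Z + (1 - e%:Z)).
- by rewrite xpair_eqE; lia.
- by move=> u /rf []; rewrite /dot /=; lia.
have {}gl x y : (x, y) \in msupp g -> 0 <= x by move=> /gl; rewrite /dot /=; lia.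
have {}gl' x y : (x, y) \in msupp g' -> 0 <= x by move=> /gl'; rewrite /dot /=; lia.
have {}gb x y : (x, y) \in msupp g -> 0 <= y by move=> /gb; rewrite /dot /=; lia.
have {}gb' x y : (x, y) \in msupp g' -> 0 <= y by move=> /gb'; rewrite /dot /=; lia.
have {}gp x y : (x, y) \in msupp g -> x <= p by move=> /gp; rewrite /dot /=; lia.
have {}gq x y : (x, y) \in msupp g' -> x <= q by move=> /gq; rewrite /dot /=; lia.
have {}gM x y : (x, y) \in msupp g -> (2 * K%:Z - 5) * y <= (2 * K%:Z - 3) * x + M1.
  by move=> /gM; rewrite /dot /=; lia.
have {}gM' x y : (x, y) \in msupp g' -> (2 * K%:Z - 5) * y <= (2 * K%:Z - 3) * x + M2.
  by move=> /gM'; rewrite /dot /=; lia.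
have {}gB x y : (x, y) \in msupp g -> (2 * K%:Z - 1) * x - 2 * y <= B1.
  by move=> /gB; rewrite /dot /=; lia.
have {}gB' x y : (x, y) \in msupp g' -> (2 * K%:Z - 1) * x - 2 * y <= B2.
  by move=> /gB'; rewrite /dot /=; lia.
have dh : (2 * K%:Z - 5) * h%:Z = (2 * K%:Z - 3) * m%:Z + e%:Z by have := dh_am; lia.
have : (m%:Z, h%:Z) \in msupp (g * g') by rewrite -fgg -mcoeff_neq0.
case/msuppM => -[x1 y1] [[x2 y2] [c1 c2 [xE yE]]].
have x1p := gp _ _ c1; have x2q := gq _ _ c2.
have {x1p x2q} [e1' e2'] : x1 = p /\ x2 = q by lia.
rewrite {x1}e1' {x2}e2' in c1 c2 xE.
have y1_0 := gb _ _ c1; have y2_0 := gb' _ _ c2.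
have [p' pE] : exists p' : nat, p = p'%:Z by exists `|p|%N; lia.
have [q' qE] : exists q' : nat, q = q'%:Z by exists `|q|%N; lia.
have [t tE] : exists t : nat, y1 = t%:Z by exists `|y1|%N; lia.
have [t' tE'] : exists t : nat, y2 = t%:Z by exists `|y2|%N; lia.
rewrite {p}pE {q}qE {y1}tE {y2}tE' in p0 q0 pq gp gq c1 c2 xE yE y1_0 y2_0.
have c1M := gM _ _ c1; have c2M := gM' _ _ c2.
have c1B := gB _ _ c1; have c2B := gB' _ _ c2.
have hE : h = (t + t')%N by lia.
have mE : m = (p' + q')%N by lia.
rewrite hE mE !PoszD in dh B12.
have D0 : 0 < 2 * K%:Z - 5 by lia.
have M1E : (2 * K%:Z - 5) * t%:Z = (2 * K%:Z - 3) * p'%:Z + M1 by lia.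
have M2E : (2 * K%:Z - 5) * t'%:Z = (2 * K%:Z - 3) * q'%:Z + M2 by lia.
(* The left edge gives y <= t. The term (q', t') of g' forces B1 <= b p' - 2 t + (1 - e), whence 2 y
   >= 2 t - 1 and y >= t. *)
have single y : (p'%:Z, y) \in msupp g -> y = t%:Z.
  move=> yg; have := gB _ _ yg; have := gM _ _ yg.
  by rewrite -M1E ler_pM2l // => yt yB; lia.
have single' y : (q'%:Z, y) \in msupp g' -> y = t'%:Z.
  move=> yg; have := gB' _ _ yg; have := gM' _ _ yg.
  by rewrite -M2E ler_pM2l // => yt yB; lia.
have [i [ip vi gi]] : exists i, [/\ (i <= p')%N, vanishes i g & moment i g != 0].
  apply: order_exists; apply: (last_column_order char0 (t := t%:Z)); last by rewrite mcoeff_neq0.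
  move=> [x y] xyg; rewrite /= (gl _ _ xyg) (gp _ _ xyg); split=> // xp.
  by rewrite xp (single y) // -xp.
have [j [jq vj gj]] : exists i, [/\ (i <= q')%N, vanishes i g' & moment i g' != 0].
  apply: order_exists; apply: (last_column_order char0 (t := t'%:Z)); last by rewrite mcoeff_neq0.
  move=> [x y] xyg; rewrite /= (gl' _ _ xyg) (gq _ _ xyg); split=> // xp.
  by rewrite xp (single' y) // -xp.
(* The leading moment of the product is nonzero, so its order i + j is at least m = p' + q'; as i <=
   p' and j <= q', both are equalities. *)
have mij : (m <= i + j)%N.
  rewrite leqNgt; apply/negP => /vf; rewrite fgg => /eqP.
  by rewrite (negPf (moment_leading_neq0 char0 vi vj gi gj)).
have [ei ej] : i = p' /\ j = q' by clear -mij mE ip jq; lia.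
rewrite {i}ei {j}ej in vi vj gi gj ip jq mij.
(* The slacks M1, M2, B1 - (b p' - 2 t) and B2 - (b q' - 2 t') are nonnegative integers with sum at
   most e + (1 - e) = 1, so one factor has slack zero on both edges. *)
have : (M1 = 0 /\ B1 = (2 * K%:Z - 1) * p'%:Z - 2 * t%:Z) \/
       (M2 = 0 /\ B2 = (2 * K%:Z - 1) * q'%:Z - 2 * t'%:Z).
  by clear -M12 B12 M1_0 M2_0 c1B c2B; lia.
case=> -[M0 BE]; [left | right].
  apply: (apex_factor_unit (p := p') (t := t)) => //; rewrite ?mcoeff_neq0 //.
    by rewrite M1E M0 addr0.
  move=> [x y] xyg /=; have := gM _ _ xyg; have := gB _ _ xyg; have := gb _ _ xyg.
  by rewrite M0 BE; clear; split; lia.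
apply: (apex_factor_unit (p := q') (t := t')) => //; rewrite ?mcoeff_neq0 //.
  by rewrite M2E M0 addr0.
move=> [x y] xyg /=; have := gM' _ _ xyg; have := gB' _ _ xyg; have := gb' _ _ xyg.
by rewrite M0 BE; clear; split; lia.
Qed.

End Factors.

Lemma is_unit_mull g g' : is_unit (g * g') -> is_unit g.
Proof. by case=> y gy; exists (g' * y); rewrite mulrA. Qed.

Lemma region_curve_irreducible f : f != 0 -> {in msupp f, forall u, in_region u} ->
  vanishes m f -> irreducible_elt f.
Proof.
move=> f0 rf vf; have fc := region_curve_corner f0 rf vf.
have fo := region_curve_origin f0 rf vf; have m1 := m_gt1.
split; first by apply/eqP.
  case=> y fy; have := vanishesM vf (vanishes0 y) (i := 0).
  rewrite fy addn0 => /(_ ltac:(lia)); rewrite /moment [X in lsum _ X]/(lone k) lsumU.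
  by rewrite expr0 scale1r => /eqP; rewrite oner_eq0.
(* The origin is a sum u + v of exponents of g and g'; shifting g by - u and g' by u puts the origin
   in both supports. *)
move=> g g' fgg; have : (0, 0) \in msupp (g * g') by rewrite -fgg -mcoeff_neq0.
case/msuppM => u [v [ug vg uv]]; have vE : v = - u.
  by apply: (addrI u); rewrite subrr -uv.
have unitU : (<< 1 *g - u >> : laurent k) * << 1 *g u >> = 1.
  by apply: etrans (lmulUU _ _ _ _) _; rewrite mul1r addNr.
have fE : f = (g * << 1 *g - u >>) * (g' * << 1 *g u >>).
  by rewrite fgg; apply: mulr_cancel_pair.
have [||/is_unit_mull|/is_unit_mull] := region_factor_unit rf vf fc fE; [| |by left|by right].
  by rewrite -[X in _@_X](subrr u) mcoeffMU mulr1 mcoeff_neq0.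
by rewrite -[X in _@_X](addNr u) mcoeffMU mulr1 -vE mcoeff_neq0.
Qed.

(** For e = 1 the corner is on the right edge. For e = 0, missing that edge would sharpen its
    inequality by one and place f in the triangle with apex (m, h), where the corner coefficient is
    zero. *)
Lemma region_curve_right_edge f : f != 0 -> {in msupp f, forall u, in_region u} ->
  vanishes m f -> exists2 u, u \in msupp f &
  (2 * K%:Z - 1) * (u.1 - m%:Z) = 2 * (u.2 - h%:Z) + (1 - e%:Z).
Proof.
move=> f0 rf vf; have := region_curve_corner f0 rf vf; rewrite mcoeff_neq0 => cf.
have [e0|e0] := posnP e; last by exists (m%:Z, h%:Z) => //=; rewrite !subrr mulr0; lia.
have [/hasP[u uf /eqP ue]|/hasPn nright] := boolP (has (fun u =>
  (2 * K%:Z - 1) * (u.1 - m%:Z) == 2 * (u.2 - h%:Z) + (1 - e%:Z)) (msupp f)).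
  by exists u.
move: cf; rewrite -mcoeff_neq0 => /eqP[]; have := m_gt1 => m1.
apply: (lattice_triangle_corner char0 K4 _ _ _ vf); first by lia.
  by have := dh_am; lia.
move=> [x y] uf; have /= := nright _ uf; have [/= y0 yx xy] := rf _ uf.
by move=> ne; split => //; move: yx xy ne; rewrite e0; lia.
Qed.

End Columns.

(** * Plane triangles *)

Section ConvexHull.
Implicit Types (S : point -> Prop) (p : point).

Lemma sub_conv_hull S p : S p -> conv_hull S p.
Proof.
move=> Sp; exists 1%N, (fun=> 1), (fun=> p); split => [i||//|//].
- by [].
- by rewrite big_ord1.
- by rewrite big_ord1 mul1r.
- by rewrite big_ord1 mul1r.
Qed.

Lemma conv_hull_ge S (n1 n2 M : rat) p :
  (forall q, S q -> M <= n1 * q.1 + n2 * q.2) -> conv_hull S p ->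
  M <= n1 * p.1 + n2 * p.2.
Proof.
move=> SM [n [w [q [wq w1 -> ->]]]].
rewrite -[M]mul1r -w1 mulr_suml !mulr_sumr -big_split /= ler_sum // => i _.
have [w0 /SM Mq] := wq i.
rewrite [n1 * _]mulrCA [n2 * _]mulrCA -mulrDr; exact: ler_wpM2l.
Qed.

Lemma region_barycentric (D : triangle) (w0 w1 w2 : rat) p :
  0 <= w0 -> 0 <= w1 -> 0 <= w2 -> w0 + w1 + w2 = 1 ->
  let D0 := D (@Ordinal 3 0 isT) in let D1 := D (@Ordinal 3 1 isT) in
  let D2 := D (@Ordinal 3 2 isT) in
  p.1 = w0 * D0.1 + w1 * D1.1 + w2 * D2.1 ->
  p.2 = w0 * D0.2 + w1 * D1.2 + w2 * D2.2 -> region D p.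
Proof.
move=> w0_0 w1_0 w2_0 w1E D0 D1 D2 p1 p2.
exists 3%N, (fun i : 'I_3 => nth 0 [:: w0; w1; w2] i), D; split.
- by move=> i; split; [case: i => [[|[|[|//]]] ?] | exists i].
- by rewrite !big_ord_recl big_ord0 /= addr0 addrA.
- rewrite p1 !big_ord_recl big_ord0 /= addr0 addrA.
  by congr (_ * (D _).1 + _ * (D _).1 + _ * (D _).1); apply: val_inj.
- rewrite p2 !big_ord_recl big_ord0 /= addr0 addrA.
  by congr (_ * (D _).2 + _ * (D _).2 + _ * (D _).2); apply: val_inj.
Qed.

End ConvexHull.

(** * Triangles given by a base and two edge lines *)

Section Triangle.
Variables (a b c d e beta : rat).
Hypotheses (a0 : 0 < a) (b0 : 0 < b) (c0 : 0 < c) (cE : c = b * d - 2 * a).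
Hypothesis (T0 : 0 < a * beta + b * e).
Local Notation T := (a * beta + b * e).

(* The triangle 0 <= y, d y <= a x + e, b x - 2 y <= beta. *)
Definition edge_triangle : triangle :=
  mk_triangle (- (e / a), 0) (beta / b, 0) ((d * (T / c) - e) / a, T / c).

Variable D : triangle.
Hypothesis DE : D =1 edge_triangle.

(* The functionals of the three edges, weighted by c, b, a, add up to T. *)
Lemma edge_triangle_region (x y : rat) :
  0 <= y -> d * y <= a * x + e -> b * x - 2 * y <= beta -> region D (x, y).
Proof.
move=> y0 yx xy.
apply: (@region_barycentric _ (a * (2 * y - b * x + beta) / T)
  (b * (a * x - d * y + e) / T) (c * y / T)); rewrite ?DE /=.
- by rewrite divr_ge0 ?(ltW T0) // mulr_ge0 ?(ltW a0) //; lra.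
- by rewrite divr_ge0 ?(ltW T0) // mulr_ge0 ?(ltW b0) //; lra.
- by rewrite divr_ge0 ?(ltW T0) // mulr_ge0 ?(ltW c0).
- by rewrite -!mulrDl cE; apply: (mulIf (lt0r_neq0 T0)); rewrite mulfVK ?lt0r_neq0 //; ring.
- have := lt0r_neq0 T0; have := lt0r_neq0 c0; rewrite cE => c1 T1; field.
  by rewrite c1 T1 !lt0r_neq0.
- have := lt0r_neq0 T0; have := lt0r_neq0 c0; rewrite cE => c1 T1; field.
  by rewrite c1 T1.
Qed.

(** Each inequality is checked at the vertices: it is an equality on its edge and has excess l T /
    c, l T / b or l T / a at the opposite vertex. *)
Lemma edge_triangle_homothet (l : rat) (v : point) p : 0 < l ->
  region (homothet l v D) p -> [/\ v.2 <= p.2,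
    a * v.1 - d * v.2 - l * e <= a * p.1 - d * p.2 &
    2 * v.2 - b * v.1 - l * beta <= 2 * p.2 - b * p.1].
Proof.
move=> l0 rp; have T1 := lt0r_neq0 T0; have c1 := lt0r_neq0 c0.
have a1 := lt0r_neq0 a0; have b1 := lt0r_neq0 b0.
have y0 : 0 <= T / c by rewrite divr_ge0 // ltW.
have L0 : 0 <= T / b by rewrite divr_ge0 // ltW.
have R0 : 0 <= T / a by rewrite divr_ge0 // ltW.
split.
- have := @conv_hull_ge _ 0 1 v.2 p _ rp; rewrite mul0r add0r mul1r; apply.
  move=> q [i ->]; rewrite /homothet DE /=.
  case: i => [[|[|[|//]]] ?] /=; rewrite mul0r add0r mul1r; try lra.
  by have := mulr_ge0 (ltW l0) y0; lra.
- have := @conv_hull_ge _ a (- d) (a * v.1 - d * v.2 - l * e) p _ rp.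
  rewrite mulNr; apply=> q [i ->]; rewrite /homothet DE /=.
  case: i => [[|[|[|//]]] ?] /=.
  + by rewrite le_eqVlt; apply/orP; left; apply/eqP; field.
  + have -> : a * (l * (beta / b) + v.1) + - d * (l * 0 + v.2) =
      a * v.1 - d * v.2 - l * e + l * (T / b) by field.
    by have := mulr_ge0 (ltW l0) L0; lra.
  + by rewrite le_eqVlt; apply/orP; left; apply/eqP; field; rewrite a1 c1.
- have -> : 2 * p.2 - b * p.1 = - b * p.1 + 2 * p.2 by ring.
  apply: (conv_hull_ge _ rp) => q [i ->]; rewrite /homothet DE /=.
  case: i => [[|[|[|//]]] ?] /=.
  + have -> : - b * (l * - (e / a) + v.1) + 2 * (l * 0 + v.2) =
      2 * v.2 - b * v.1 - l * beta + l * (T / a) by field.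
    by have := mulr_ge0 (ltW l0) R0; lra.
  + by rewrite le_eqVlt; apply/orP; left; apply/eqP; field.
  + rewrite le_eqVlt; apply/orP; left; apply/eqP.
    by move: c1; rewrite cE => c1; field; rewrite a1 c1.
Qed.

(** The base has length T / (a b) and the height is T / c. *)
Lemma edge_triangle_area : 2 * area D = T ^+ 2 / (a * b * c).
Proof.
have a1 := lt0r_neq0 a0; have b1 := lt0r_neq0 b0; have c1 := lt0r_neq0 c0.
rewrite /area !DE /= subrr mulr0 !subr0.
have -> : (beta / b - - (e / a)) * (T / c) = T ^+ 2 / (a * b * c).
  by field; rewrite a1 b1 c1.
rewrite ger0_norm; first by rewrite mulrC divfK.
by rewrite divr_ge0 ?sqr_ge0 // !mulr_ge0 // ltW.
Qed.

Lemma edge_triangle_slopes : 0 < d -> horizontal_base_slopes D (a / d) (b / 2).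
Proof.
move=> d0; have a1 := lt0r_neq0 a0; have b1 := lt0r_neq0 b0.
have c1 := lt0r_neq0 c0; have d1 := lt0r_neq0 d0; have T1 := lt0r_neq0 T0.
rewrite /horizontal_base_slopes /has_slope !DE /=.
have -> : (d * (T / c) - e) / a - - (e / a) = d * (T / c) / a by field; rewrite c1 a1.
have -> : (d * (T / c) - e) / a - beta / b = 2 * (T / c) / b.
  by move: c1; rewrite cE => c1; field; rewrite a1 b1 c1.
split=> //.
- split=> //; rewrite -subr_gt0.
  have -> : beta / b - - (e / a) = T / (a * b) by field; rewrite a1 b1.
  by rewrite divr_gt0 // mulr_gt0.
- by rewrite divr_gt0.
- split; last by rewrite subr0; field; rewrite a1 c1 d1 T1.
  rewrite eq_sym -subr_eq0.
  have -> : (d * (T / c) - e) / a - - (e / a) = d * (T / c) / a by field; rewrite c1 a1.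
  by rewrite lt0r_neq0 // divr_gt0 // mulr_gt0 // divr_gt0.
- split; last by rewrite subr0; field; rewrite b1 c1 T1.
  rewrite eq_sym -subr_eq0.
  have -> : (d * (T / c) - e) / a - beta / b = 2 * (T / c) / b.
    by move: c1; rewrite cE => c1; field; rewrite a1 b1 c1.
  by rewrite lt0r_neq0 // divr_gt0 // mulr_gt0 // divr_gt0.
rewrite divr_gt0 //= ltr_pdivrMr // mulrAC ltr_pdivlMr //.
by rewrite -subr_gt0 -[X in 0 < _ - X]mulrC -cE.
Qed.

Context {k : comNzRingType}.
Variable f : laurent k.

(** Since f touches all three edges, the edge inequalities of a homothetic copy containing a
    translate of f, weighted by c, b, a, add up to T <= l T: the translations cancel. *)
Lemma edge_triangle_smallest :
  {in msupp f, forall u : int * int, [/\ 0 <= u.2%:~R :> rat,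
    d * u.2%:~R <= a * u.1%:~R + e & b * u.1%:~R - 2 * u.2%:~R <= beta]} ->
  (exists2 u : int * int, u \in msupp f & u.2 = 0) ->
  (exists2 u : int * int, u \in msupp f & d * u.2%:~R = a * u.1%:~R + e) ->
  (exists2 u : int * int, u \in msupp f & b * u.1%:~R - 2 * u.2%:~R = beta) ->
  smallest_supporting f D.
Proof.
move=> sf [u0 f0 u0E] [u1 f1 u1E] [u2 f2 u2E]; split.
  exists 0 => p fp; rewrite (_ : p + of_lattice 0 = p); last first.
    by case: p {fp} => x y; rewrite /of_lattice /= -[LHS]/(x + 0, y + 0) !addr0.
  rewrite [p]surjective_pairing; apply: edge_triangle_region.
  - have := @conv_hull_ge _ 0 1 0 p _ fp; rewrite mul0r add0r mul1r; apply.
    by move=> q [u /sf[u20 _ _] ->]; rewrite /= mul0r add0r mul1r.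
  - rewrite -subr_ge0; have := @conv_hull_ge _ a (- d) (- e) p _ fp.
    move=> H; suff : - e <= a * p.1 + - d * p.2 by lra.
    by apply: H => q [u /sf[_ u12 _] ->] /=; lra.
  - have H := @conv_hull_ge _ (- b) 2 (- beta) p _ fp.
    suff : - beta <= - b * p.1 + 2 * p.2 by lra.
    by apply: H => q [u /sf[_ _ u12] ->] /=; lra.
move=> l v l0 [w sw].
have touch u : u \in msupp f ->
    region (homothet l v D) (of_lattice u + of_lattice w).
  by move=> uf; apply: sw; apply: sub_conv_hull; exists u.
have [+ _ _] := edge_triangle_homothet l0 (touch _ f0).
have [_ + _] := edge_triangle_homothet l0 (touch _ f1).
have [_ _ +] := edge_triangle_homothet l0 (touch _ f2).
rewrite /of_lattice u0E /= add0r => E2 E1 E0.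
have E0' : 0 <= c * (w.2%:~R - v.2) by rewrite mulr_ge0 ?(ltW c0) // subr_ge0.
have {E1} : 0 <= b * (a * w.1%:~R - d * w.2%:~R - e - (a * v.1 - d * v.2 - l * e)).
  by rewrite mulr_ge0 ?(ltW b0) //; lra.
have {E2} : 0 <= a * (2 * w.2%:~R - b * w.1%:~R - beta - (2 * v.2 - b * v.1 - l * beta)).
  by rewrite mulr_ge0 ?(ltW a0) //; lra.
move=> E2 E1; rewrite -(ler_pM2r T0) mul1r -subr_ge0.
apply: le_trans (addr_ge0 (addr_ge0 E0' E1) E2) _; rewrite cE le_eqVlt.
by apply/orP; left; apply/eqP; ring.
Qed.

End Triangle.

Lemma ord3_ind (P : 'I_3 -> Prop) : P (@Ordinal 3 0 isT) -> P (@Ordinal 3 1 isT) ->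
  P (@Ordinal 3 2 isT) -> forall i, P i.
Proof.
move=> P0 P1 P2 [[|[|[|//]]] lt3].
- by rewrite (_ : Ordinal lt3 = @Ordinal 3 0 isT) //; apply: val_inj.
- by rewrite (_ : Ordinal lt3 = @Ordinal 3 1 isT) //; apply: val_inj.
- by rewrite (_ : Ordinal lt3 = @Ordinal 3 2 isT) //; apply: val_inj.
Qed.

Lemma sum_ord3 (V : nmodType) (F : 'I_3 -> V) :
  \sum_i F i = F (@Ordinal 3 0 isT) + F (@Ordinal 3 1 isT) + F (@Ordinal 3 2 isT).
Proof.
rewrite !big_ord_recl big_ord0 addr0 addrA.
by congr (F _ + F _ + F _); apply: val_inj.
Qed.

(** The normals (-b, 2), (a, -d), (0, 1) satisfy the relation with weights a, b, c. The identity a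
    (K - 1) - b (K - 2) = 1 shows that they generate the lattice and that every relation is a
    multiple of this one. *)
Lemma edge_triangle_toric (K : nat) (a b c d : int) (e beta : rat) (D : triangle) :
  (4 <= K)%N -> a = 2 * K%:Z - 3 -> b = 2 * K%:Z - 1 -> d = 2 * K%:Z - 5 ->
  c = b * d - 2 * a -> 0 < a%:~R * beta + b%:~R * e ->
  D =1 edge_triangle a%:~R b%:~R c%:~R d%:~R e beta -> toric_surface_is_wps D a b c.
Proof.
move=> K4 aE bE dE cE T0 DE.
have a1 : 0 < a%:~R :> rat by rewrite ltr0z; lia.
have b1 : 0 < b%:~R :> rat by rewrite ltr0z; lia.
have c1 : 0 < c%:~R :> rat by rewrite ltr0z; nia.
have cE' : c%:~R = b%:~R * d%:~R - 2 * a%:~R :> rat by rewrite cE; ring.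
have a0 := lt0r_neq0 a1; have b0 := lt0r_neq0 b1; have c0 := lt0r_neq0 c1.
have Tc : 0 < (a%:~R * beta + b%:~R * e) / c%:~R by rewrite divr_gt0.
have Tb : 0 < (a%:~R * beta + b%:~R * e) / b%:~R by rewrite divr_gt0.
have Ta : 0 < (a%:~R * beta + b%:~R * e) / a%:~R by rewrite divr_gt0.
pose n (i : 'I_3) : int * int := nth (0, 0) [:: (- b, 2); (a, - d); (0, 1)] i.
exists n; split.
- elim/ord3_ind; rewrite /primitive_inner_normal /n /=; split.
  + by apply/eqP/coprimezP; exists (1, K%:Z); rewrite /= bE; ring.
  + exists (- beta); split; last elim/ord3_ind => // _; rewrite !DE /=.
    * have -> : (- b)%:~R * - (e / a%:~R) + 2%:~R * 0 =
        - beta + (a%:~R * beta + b%:~R * e) / a%:~R :> rat by field.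
      by rewrite ltrDl.
    * by field.
    * by move: c0; rewrite cE' => c0; field; rewrite a0 c0.
  + by apply/eqP/coprimezP; exists (3 - K%:Z, - (K%:Z - 2)); rewrite /= aE dE; ring.
  + exists (- e); split; last elim/ord3_ind => // _; rewrite !DE /=.
    * have -> : a%:~R * (beta / b%:~R) + (- d)%:~R * 0 =
        - e + (a%:~R * beta + b%:~R * e) / b%:~R :> rat by field.
      by rewrite ltrDl.
    * by field.
    * by field; rewrite a0 c0.
  + by [].
  + exists 0; split; last elim/ord3_ind => // _; rewrite !DE /=; try by ring.
    by rewrite mul0r add0r mul1r.
(* The first two coefficients reach u.1 by the Bezout identity; the third corrects the second
   coordinate. *)
- move=> u; exists (fun i => nth 0 [:: (K%:Z - 2) * u.1; (K%:Z - 1) * u.1;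
    u.2 - 2 * ((K%:Z - 2) * u.1) + d * ((K%:Z - 1) * u.1)] i).
  by rewrite !sum_ord3 /n /= aE bE; split; ring.
move=> z; rewrite !sum_ord3 /n /=; split=> [[z1 z2]|[t zt]]; last first.
  by rewrite !zt /= cE; split; ring.
pose z0 := z (@Ordinal 3 0 isT); pose z1' := z (@Ordinal 3 1 isT).
have bez : a * (K%:Z - 1) - b * (K%:Z - 2) = 1 by rewrite aE bE; ring.
have zab : b * z0 = a * z1'.
  by apply/eqP; rewrite -subr_eq0 -oppr_eq0 opprB addrC -z1; apply/eqP; ring.
exists ((K%:Z - 1) * z0 - (K%:Z - 2) * z1').
have e0 : z0 = ((K%:Z - 1) * z0 - (K%:Z - 2) * z1') * a.
  transitivity (z0 * (a * (K%:Z - 1) - b * (K%:Z - 2))); first by rewrite bez mulr1.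
  transitivity (z0 * (a * (K%:Z - 1)) - (K%:Z - 2) * (b * z0)); first by ring.
  by rewrite zab; ring.
have e1 : z1' = ((K%:Z - 1) * z0 - (K%:Z - 2) * z1') * b.
  transitivity (z1' * (a * (K%:Z - 1) - b * (K%:Z - 2))); first by rewrite bez mulr1.
  transitivity ((K%:Z - 1) * (a * z1') - b * (K%:Z - 2) * z1'); first by ring.
  by rewrite -zab; ring.
move: e0 e1; set r := _ - (K%:Z - 2) * z1' => e0 e1; elim/ord3_ind => //=.
transitivity (d * z1' - 2 * z0); last by rewrite cE e0 e1; ring.
by apply/eqP; rewrite -subr_eq0 -z2; apply/eqP; ring.
Qed.

Lemma in_region_rat (K e m h : nat) u : in_region K e m h u ->
  [/\ 0 <= u.2%:~R :> rat,
   (2 * K%:R - 5) * u.2%:~R <= (2 * K%:R - 3) * u.1%:~R + e%:R :> rat &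
   (2 * K%:R - 1) * u.1%:~R - 2 * u.2%:~R <=
     (2 * K%:R - 1) * m%:R - 2 * h%:R + (1 - e%:R) :> rat].
Proof.
case=> y0 yx xy; move: yx xy; rewrite -2!(ler_int rat) => yx xy.
by split; [rewrite ler0z | lra | lra].
Qed.

Theorem theorem4p1 (k : closedFieldType) (char0 : [pchar k] =i pred0)
    (K : nat) (HK : (4 <= K)%N) (a b c d : int) (m : nat)
    (Ha : a = 2 * K%:Z - 3) (Hb : b = 2 * K%:Z - 1)
    (Hc : c = 4 * K%:Z ^+ 2 - 16 * K%:Z + 11) (Hd : d = 2 * K%:Z - 5)
    (Hm : m%:Z = Num.ceil (K%:R ^+ 2 - 7 / 2 * K%:R + 2 : rat)) :
  let aq : rat := a%:~R in let bq : rat := b%:~R in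
  let cq : rat := c%:~R in let dq : rat := d%:~R in
  let Kq : rat := K%:R in let mq : rat := m%:R in
  let s := aq / dq in
  let t := bq / 2 in
  let Delta :=
    if odd K then
      mk_triangle (0, 0) (mq - Kq + 2, 0)
        (((Kq - 1) / 2 + cq^-1) * dq, ((Kq - 1) / 2 + cq^-1) * aq)
    else
      mk_triangle (- aq^-1, 0) (mq - Kq + 2, 0) (mq, (Kq - 2) * bq / 2) in
  [/\ s = 1 + 2 / (2 * Kq - 5),
      t = Kq - 1 / 2,
      toric_surface_is_wps Delta a b c,
      horizontal_base_slopes Delta s t &
      exists xi : laurent k,
        [/\ negative_curve Delta xi, order_at_e xi m &
            smallest_supporting xi Delta]].
Proof.
move=> aq bq cq dq Kq mq s t Delta.
(* The difference of 2 h + e and 2 m + e is (a - d) (K - 1) = 2 (K - 1), which fixes h. *)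
pose e : nat := ~~ odd K; pose h := (m + K - 1)%N.
have e1 : (e <= 1)%N by rewrite /e; case: odd.
(* The ceiling confines 2 m to the two values 2 K^2 - 7 K + 4 and 2 K^2 - 7 K + 5; the parity of K
   selects one. *)
have em : (2 * m + e = (2 * K - 5) * (K - 1))%N.
  have := ceil_itv (K%:R ^+ 2 - 7 / 2 * K%:R + 2 : rat); rewrite -Hm => /andP[mlt mge].
  have lo : 2 * K%:Z ^+ 2 - 7 * K%:Z + 4 <= 2 * m%:Z by rewrite -(ler_int rat); lra.
  have hi : 2 * m%:Z < 2 * K%:Z ^+ 2 - 7 * K%:Z + 6 by rewrite -(ltr_int rat); lra.
  rewrite /e; nia.
have eh : (2 * h + e = (2 * K - 3) * (K - 1))%N by rewrite /h; nia.
have aqE : aq = 2 * Kq - 3 by rewrite /aq Ha; ring.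
have bqE : bq = 2 * Kq - 1 by rewrite /bq Hb; ring.
have dqE : dq = 2 * Kq - 5 by rewrite /dq Hd; ring.
have cqE : cq = 4 * Kq ^+ 2 - 16 * Kq + 11 by rewrite /cq Hc; ring.
have K4 : 4 <= Kq by rewrite /Kq (ler_nat _ 4).
have a0 : 0 < aq by lra.
have b0 : 0 < bq by lra.
have d0 : 0 < dq by lra.
have c0 : 0 < cq by rewrite cqE; nra.
have cE : cq = bq * dq - 2 * aq by rewrite cqE aqE bqE dqE; ring.
pose eq : rat := e%:R.
have mE : mq = (dq * (Kq - 1) - eq) / 2.
  have : 2 * m%:Z + e%:Z = (2 * K%:Z - 5) * (K%:Z - 1) by nia.
  move/(congr1 (fun z : int => z%:~R : rat)) => E.
  by rewrite dqE /mq /eq /Kq; lra.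
have hE : h%:R = mq + Kq - 1 :> rat.
  have : (h + 1 = m + K)%N by rewrite /h; lia.
  by move/(congr1 (fun n => n%:R : rat)); rewrite !natrD /mq /Kq => ?; lra.
pose beta := bq * (mq - Kq + 2).
have betaE : beta = ((Kq - 1) * cq - aq * eq) / 2 + 1 - eq.
  by rewrite /beta mE cqE aqE bqE dqE; field.
have DE : Delta =1 edge_triangle aq bq cq dq eq beta.
  have a1 := lt0r_neq0 a0; have c1 := lt0r_neq0 c0.
  have D1 : mq - Kq + 2 = beta / bq by rewrite /beta mulrC mulKf ?lt0r_neq0.
  rewrite /Delta; case: ifP => oK; elim/ord3_ind; rewrite /edge_triangle /= ?D1 //.
  - by rewrite /eq /e oK mul0r oppr0.
  - by rewrite betaE /eq /e oK /=; congr pair; field; rewrite ?a1 c1.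
  - by rewrite /eq /e oK /= div1r.
  have -> : (aq * beta + bq * eq) / cq = (aq * (Kq - 1) - 1) / 2.
    rewrite betaE /eq /e oK /=; move: c1; rewrite cqE => c1; rewrite aqE bqE.
    by field.
  rewrite mE /eq /e oK /=; congr pair; last by rewrite aqE bqE; field.
  by move: a1; rewrite aqE dqE => a1; field.
have K1 : 3 <= Kq - 1 by lra.
have as1 : 1 < aq * (Kq - 1) by rewrite aqE; nra.
have TE : aq * beta + bq * eq = if odd K then aq * ((Kq - 1) * cq / 2 + 1)
    else cq * ((aq * (Kq - 1) - 1) / 2).
  by rewrite betaE /eq /e; case: odd; rewrite /= cqE aqE bqE; field.
have T0 : 0 < aq * beta + bq * eq.
  rewrite TE; case: odd; rewrite mulr_gt0 ?divr_gt0 //; last by lra.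
  by rewrite ltr_wpDl // divr_ge0 // mulr_ge0 ?(ltW c0) //; lra.
(* This is C.C <= 0. Once denominators are cleared, the difference is a (c (K - 1) - a) for odd K
   and c (2 a (K - 1) + a + b) / 2 for even K. *)
have area_le : (aq * beta + bq * eq) ^+ 2 / (aq * bq * cq) <= mq ^+ 2.
  rewrite ler_pdivrMr ?mulr_gt0 // -subr_ge0 TE mE /eq /e; case: odd => /=.
    have -> : ((dq * (Kq - 1) - 0%:R) / 2) ^+ 2 * (aq * bq * cq) -
        (aq * ((Kq - 1) * cq / 2 + 1)) ^+ 2 = aq * ((Kq - 1) * cq - aq).
      by rewrite cqE dqE bqE aqE; field.
    by rewrite mulr_ge0 ?(ltW a0) // cqE aqE; nra.
  have -> : ((dq * (Kq - 1) - 1%:R) / 2) ^+ 2 * (aq * bq * cq) -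
      (cq * ((aq * (Kq - 1) - 1) / 2)) ^+ 2 = cq * (2 * aq * (Kq - 1) + aq + bq) / 2.
    by rewrite cqE dqE bqE aqE; field.
  by rewrite divr_ge0 // mulr_ge0 ?(ltW c0) //; lra.
split.
- by rewrite /s aqE dqE; field; rewrite -dqE lt0r_neq0.
- by rewrite /t bqE; field.
- apply: (edge_triangle_toric HK Ha Hb Hd _ T0 DE).
  by rewrite Hc Ha Hb Hd; ring.
- exact: (edge_triangle_slopes a0 b0 c0 cE T0 DE d0).
have [f [f0 rf If]] := exists_region_curve (k := k) HK e1 em eh.
have vf := ideal_vanishes If.
have fo := region_curve_origin HK e1 em eh char0 f0 rf vf.
have fc := region_curve_corner HK e1 em eh char0 f0 rf vf.
have [u uf uE] := region_curve_right_edge HK e1 em eh char0 f0 rf vf.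
have betaE' : beta = (2 * Kq - 1) * mq - 2 * h%:R + (1 - eq).
  by rewrite hE betaE mE cqE aqE dqE; field.
have small (D : triangle) : D =1 edge_triangle aq bq cq dq eq beta -> smallest_supporting f D.
  move=> DE'; apply: (edge_triangle_smallest a0 b0 c0 cE T0 DE').

  - by move=> v /rf /in_region_rat; rewrite aqE bqE dqE betaE'.
  - by exists (0, 0); rewrite -?mcoeff_neq0.
  - exists (m%:Z, h%:Z); rewrite -?mcoeff_neq0 //= -!pmulrn hE.
    by rewrite -/mq mE aqE dqE; field.
  exists u => //; move/(congr1 (fun z : int => z%:~R : rat)): uE => uE.
  by rewrite betaE' bqE /mq /Kq /eq; lra.
(* The self-intersection is computed on the triangle itself, as its homothet of ratio 1 and
   translation 0. *)
have homothet1 : homothet 1 (0, 0) Delta =1 edge_triangle aq bq cq dq eq beta.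
  by move=> i; rewrite -DE /homothet /= !mul1r !addr0; case: (Delta i).
have ord_f : order_at_e f m.
  split=> // /ideal_vanishes; exact: (region_curve_order HK e1 em eh char0 f0 rf vf).
exists f; split=> //; last exact: small.
split; first exact: (region_curve_irreducible HK e1 em eh char0 f0 rf vf).
exists (2 * area Delta - mq ^+ 2).
  exists 1, (0, 0), m; split=> //; first exact: small.
  by rewrite (edge_triangle_area a0 b0 c0 DE) (edge_triangle_area a0 b0 c0 homothet1).
by rewrite (edge_triangle_area a0 b0 c0 DE) subr_le0.
Qed.
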